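(* Let $A$ be an integral Noetherian domain with fraction field $K$, let $n\ge2$, let $d$ be a finitely generated torsion-free $A$-module of rank $n$, and let $V=d\otimes_AK$. The map $d^1$ on coefficients $$\widetilde{St}(d)\longrightarrow\Big(\bigoplus_{W<V,\ \dim W=n-1}\widetilde{St}(W)\Big)\oplus\Big(\bigoplus_{L<V,\ \dim L=1}\widetilde{St}(V/L)\Big)$$ (where the summand $\widetilde{St}(W)=\widetilde{St}(c)$, $c=d\cap W$, is indexed by the layer $(0,W)$, and the summand $\widetilde{St}(V/L)$ by the layer $(L,V)$) is given, for non-zero $g_1,\dots,g_n\in V$, by $$\partial(0,g_1,\dots,g_n)\longmapsto-\sum_{i=1}^n(-1)^i\big((0,W_i),\ \partial(0,g_1,\dots,\widehat{g_i},\dots,g_n)\big)+\sum_{i=1}^n(-1)^i\big((L_i,V),\ \partial(0,\bar g_1,\dots,\widehat{g_i},\dots,\bar g_n)\big),$$ where $W_i=\langle g_1,\dots,\widehat{g_i},\dots,g_n\rangle$, $L_i=\langle g_i\rangle$, and in the $i$-th term $\bar g_j$ is the image of $g_j$ in $V/L_i$.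
   Context: **Symbols.** For a finite-dimensional vector space $V$ of dimension $m\ge1$, $E^*(V)$ is the simplicial complex with vertex set $V$ whose simplices are the non-empty finite $X\subset V$ such that $0\in X$ implies $\langle X\rangle\neq V$. Chains are ordered simplicial chains: $C_p$ is free abelian on tuples $(v_0,\dots,v_p)$ whose entries form a simplex. $\partial(0,g_1,\dots,g_m)=(g_1,\dots,g_m)+\sum_i(-1)^i(0,g_1,\dots,\widehat{g_i},\dots,g_m)$ is a cycle of $E^*(V)$ and also denotes its class in $\widetilde H_{m-1}(E^*(V))$. Terms in the formula whose entries do not span the relevant $(n-1)$-dimensional space are read as $0$. **Layers.** $J(V)$ is the poset of pairs (proper layers) $(W_0,W_1)$ of subspaces $W_0\le W_1\le V$ other than $(0,V)$, with $(W_0,W_1)\le(W_0',W_1')$ iff $W_0'\le W_0\le W_1\le W_1'$. The poset map $(X_0\subsetneq\cdots\subsetneq X_p)\mapsto(\langle X_0\rangle,\langle X_p\rangle)$ from chains of simplices of $E^*(V)$ to $J(V)$ is a homotopy equivalence. Through it $\widetilde{St}(V):=\widetilde H_{m-1}(J(V))$ is identified with $\widetilde H_{m-1}(E^*(V))$. For a torsion-free module $c$ of rank $m$, $\widetilde{St}(c)=\widetilde{St}(c\otimes K)$. **The map $d^1$ on coefficients.** Let $Q_m$ be the full subcategory of Quillen's $Q$-construction on finitely generated torsion-free $A$-modules consisting of modules of rank $\le m$. Let $U:Q_{n-2}\to Q_{n-1}$, $T:Q_{n-1}\to Q_n$, $T':Q_{n-1}-Q_{n-2}\to Q_n-Q_{n-2}$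 be the inclusions, and write $\mathbb F_T(d)=T\downarrow d$ for the comma category, etc. Then $\mathbb F_T(d)\simeq J(V)$ through $(c\overset{\phi}\twoheadleftarrow c'\rightarrowtail d)\mapsto(\ker\phi\otimes K,\ c'\otimes K)$. $\mathbb F_{TU}(d)$ corresponds to the subposet $J_{\le n-2}$ of layers $(W_0,W_1)$ with $\dim W_1/W_0\le n-2$. $\mathbb F_{T'}(d)$ corresponds to the discrete set of layers of dimension $n-1$, namely $(0,W)$ with $\dim W=n-1$ (admissible monomorphisms $d\cap W\rightarrowtail d$) and $(L,V)$ with $\dim L=1$ (admissible epimorphisms $d\twoheadrightarrow d/(d\cap L)$). $d^1$ on coefficients is the boundary map $\widetilde H_{n-1}(\mathbb F_T(d))\to\bigoplus_{c\to d\in\mathbb F_{T'}(d)}\widetilde H_{n-2}(\mathbb F_U(c))$ of the distinguished triangle $$\bigoplus_{c\to d\in\mathbb F_{T'}(d)}\widetilde C_*(\mathbb F_U(c))\to\widetilde C_*(\mathbb F_{TU}(d))\to\widetilde C_*(\mathbb F_T(d))\xrightarrow{+1}.$$ Concretely, $J(V)$ is obtained from $J_{\le n-2}$ by adding, for each layer $\ell$ of dimension $n-1$, a cone over the subposet $J(V)_{<\ell}$ (with $J(V)_{<(0,W)}=J(W)$ and $J(V)_{<(L,V)}\simeq J(V/L)$ via $(W,W')\mapsto(W/L,W'/L)$). The boundary map follows the Mayer–Vietoris convention: a cycle is written as $z=z_1+z_2$ with $z_1$ a chain on $J_{\le n-2}$ and $z_2$ a chain on the cones, and is sent to the class of $\partial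 z_1=-\partial z_2$ in $\bigoplus_\ell\widetilde H_{n-2}(J(V)_{<\ell})$. *)

(* Defs.v *)
From HB Require Import structures.
From mathcomp Require Import all_boot all_order all_algebra.
From mathcomp Require Import boolp.
From mathcomp Require Import finmap.
From mathcomp.multinomials Require Import freeg.

Set Implicit Arguments.
Unset Strict Implicit.
Unset Printing Implicit Defensive.

Import GRing.Theory.
Import VectorInternalTheory.

Local Open Scope ring_scope.
Local Open Scope quotient_scope.

(** * Ordered chains *)

Definition omit (T : Type) (i : nat) (s : seq T) := take i s ++ drop i.+1 s.

(* A tuple [v_0, ..., v_p] is a sequence of size [p + 1]; the empty sequence
   spans the augmentation degree [-1], so that cycles below are reduced ones. *)
Notation chain T := {freeg (seq T)}.

HB.instance Definition _ (K : choiceType) (M : lmodType int) (f : K -> M) :=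
  GRing.isZmodMorphism.Build {freeg K / int} M (fglift f) (lift_is_additive f).

Lemma raddf_scalez (U V : lmodType int) (f : {additive U -> V}) (k : int) u :
  f (k *: u) = k *: f u.
Proof. by rewrite -[k]intz !scaler_int raddfMz. Qed.

Section Chains.
Variable T : choiceType.
Implicit Types (s : seq T) (c : chain T) (M : lmodType int).

Definition bd c : chain T :=
  fglift (fun s => \sum_(i < size s) (-1) ^+ i *: (<< omit i s >> : chain T)) c.

Definition cone (b : T) c : chain T := fglift (fun s => << b :: s >> : chain T) c.

Definition part (x : T) c : chain T :=
  fglift (fun s => if x \in s then << s >> else 0 : chain T) c.

Definition supported (P : pred (seq T)) c := all P (dom c).

Lemma fgliftE M (f : seq T -> M) c :
  fglift f c = \sum_(s <- dom c) coeff s c *: f s.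
Proof.
rewrite -{1}[c]freeg_sumE raddf_sum /=.
by apply: eq_bigr => s _; rewrite liftU.
Qed.

Lemma fgliftU M (f : seq T -> M) s : fglift f << s >> = f s.
Proof. by rewrite liftU scale1r. Qed.

Lemma chain_ext M (f g : {additive chain T -> M}) :
  (forall s, f << s >> = g << s >>) -> f =1 g.
Proof.
move=> fg c; rewrite -[c]freeg_sumE !raddf_sum; apply: eq_bigr => s _.
have -> : << coeff s c *g s >> = << s >> *~ coeff s c :> chain T.
  by rewrite freegU_mulz intz.
by rewrite !raddfMz fg.
Qed.

HB.instance Definition _ :=
  GRing.isZmodMorphism.Build (chain T) (chain T) bd (lift_is_additive _).
HB.instance Definition _ b :=
  GRing.isZmodMorphism.Build (chain T) (chain T) (cone b) (lift_is_additive _).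
HB.instance Definition _ x :=
  GRing.isZmodMorphism.Build (chain T) (chain T) (part x) (lift_is_additive _).

Lemma coneU b s : cone b << s >> = << b :: s >>.
Proof. exact: fgliftU. Qed.

Lemma bdU s : bd << s >> = \sum_(i < size s) (-1) ^+ i *: (<< omit i s >> : chain T).
Proof. exact: fgliftU. Qed.

Lemma bd_nil : bd << [::] >> = 0.
Proof. by rewrite bdU big_ord0. Qed.

Lemma bd_cons x s : bd << x :: s >> = << s >> - cone x (bd << s >>).
Proof.
rewrite !bdU [LHS]big_ord_recl expr0 scale1r /omit /= drop0; congr (_ + _).
rewrite raddf_sum -sumrN; apply: eq_bigr => i _.
by rewrite raddf_scalez /= coneU exprS mulN1r scaleNr.
Qed.

Lemma bd_cone b c : bd (cone b c) = c - cone b (bd c).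
Proof.
pose f := bd \o cone b; pose g := idfun \- (cone b \o bd).
apply: (chain_ext (f := f) (g := g)) c => s.
by rewrite /f /g /= coneU bd_cons.
Qed.

Lemma bdK c : bd (bd c) = 0.
Proof.
pose f := bd \o @bd.
apply: (chain_ext (f := f) (g := \0)) c => s /=; rewrite /f /=.
elim: s => [|x s IHs]; first by rewrite bd_nil raddf0.
by rewrite bd_cons raddfB /= bd_cone IHs raddf0 subr0 subrr.
Qed.

Lemma supported0 P : supported P 0.
Proof. by rewrite /supported dom0. Qed.

Lemma supportedD P c c' : supported P c -> supported P c' -> supported P (c + c').
Proof.
move=> /allP Pc /allP Pc'; apply/allP => s /domD_subset.
by rewrite mem_cat => /orP[/Pc|/Pc'].
Qed.

Lemma supportedN P c : supported P (- c) = supported P c.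
Proof. by apply: eq_all_r => s; rewrite domN. Qed.

Lemma supportedB P c c' : supported P c -> supported P c' -> supported P (c - c').
Proof. by move=> Pc Pc'; apply: supportedD; rewrite ?supportedN. Qed.

Lemma supportedZ P k c : supported P c -> supported P (k *: c).
Proof. by move=> /allP Pc; apply/allP => s /domZ_subset/Pc. Qed.

Lemma supportedU P s : supported P << s >> = P s.
Proof. by rewrite /supported domU1 /= andbT. Qed.

Lemma supported_sum P (I : eqType) (r : seq I) (F : I -> chain T) :
  {in r, forall i, supported P (F i)} -> supported P (\sum_(i <- r) F i).
Proof.
move=> PF; rewrite big_seq; elim/big_ind: _ => //; first exact: supported0.
exact: supportedD.
Qed.

Lemma supported_sub (P Q : pred (seq T)) c :
  (forall s, P s -> Q s) -> supported P c -> supported Q c.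
Proof. by move=> PQ; apply: sub_all. Qed.

Lemma supported_bd (P Q : pred (seq T)) c :
  (forall s i, P s -> (i < size s)%N -> Q (omit i s)) ->
  supported P c -> supported Q (bd c).
Proof.
move=> PQ /allP Pc; rewrite /bd fgliftE; apply: supported_sum => s /Pc Ps.
apply/supportedZ/supported_sum => i _; apply: supportedZ.
by rewrite supportedU PQ.
Qed.
End Chains.

Lemma supported_lift (T U : choiceType) (P : pred (seq T)) (Q : pred (seq U))
    (f : seq T -> chain U) (c : chain T) :
  (forall s, P s -> supported Q (f s)) ->
  supported P c -> supported Q (fglift f c).
Proof.
move=> PQ /allP Pc; rewrite fgliftE; apply: supported_sum => s /Pc Ps.
exact/supportedZ/PQ.
Qed.

Section Push.
Variables (T U : choiceType) (f : T -> U).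

Definition push (c : chain T) : chain U :=
  fglift (fun s => << map f s >> : chain U) c.

HB.instance Definition _ :=
  GRing.isZmodMorphism.Build (chain T) (chain U) push (lift_is_additive _).

Lemma pushU s : push << s >> = << map f s >>.
Proof. exact: fgliftU. Qed.

Lemma bd_push c : bd (push c) = push (bd c).
Proof.
apply: (chain_ext (f := @bd U \o push) (g := push \o @bd T)) c => s /=.
rewrite pushU; elim: s => [|x s IHs]; first by rewrite !bd_nil raddf0.
rewrite /= !bd_cons raddfB /= pushU IHs; congr (_ - _).
apply: (chain_ext (f := cone (f x) \o push) (g := push \o cone x)) => t /=.
by rewrite coneU !pushU coneU.
Qed.
End Push.

(** * Simplicial complexes and their reduced homology *)

Record scomplex (T : choiceType) := SComplex {
  simplex :> pred {fset T};
  simplex_neq0 : forall X, simplex X -> X != fset0;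
  simplex_sub : forall X Y, simplex X -> (Y `<=` X)%fset -> Y != fset0 -> simplex Y
}.

Section OrderComplex.
Variables (T : choiceType) (r : rel T) (D : pred T).

Definition order_simplex (X : {fset T}) :=
  [&& X != fset0, all D X & all2rel (fun x y => r x y || r y x) X].

Fact order_simplex_neq0 X : order_simplex X -> X != fset0.
Proof. by case/and3P. Qed.

Fact order_simplex_sub X Y :
  order_simplex X -> (Y `<=` X)%fset -> Y != fset0 -> order_simplex Y.
Proof.
case/and3P=> _ /allP DX /allrelP rX /fsubsetP YX Y0; rewrite /order_simplex Y0 /=.
by apply/andP; split; [apply/allP => x /YX/DX | apply/allrelP => x y /YX xX /YX yX; exact: rX].
Qed.

(* The simplices are the non-empty finite chains of the poset [D] under [r]. *)
Definition order_complex := SComplex order_simplex_neq0 order_simplex_sub.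
End OrderComplex.

Section Homology.
Variables (T : choiceType) (K : scomplex T) (p : nat).

Definition tuple_in (s : seq T) := (size s == p.+1) && K [fset x in s]%fset.

Definition cycles : {pred chain T} := [pred c | supported tuple_in c && (bd c == 0)].

Fact cycles_closed : zmod_closed cycles.
Proof.
split; first by rewrite inE supported0 raddf0 eqxx.
move=> c c'; rewrite !inE => /andP[Kc /eqP c0] /andP[Kc' /eqP c'0].
by rewrite supportedB //= raddfB /= c0 c'0 subr0.
Qed.
HB.instance Definition _ := GRing.isZmodClosed.Build (chain T) cycles cycles_closed.

Record cycle := Cycle { cycle_val :> chain T; _ : cycle_val \in cycles }.
HB.instance Definition _ := [isSub for cycle_val].
HB.instance Definition _ := [Choice of cycle by <:].
HB.instance Definition _ := [SubChoice_isSubZmodule of cycle by <:].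
End Homology.

Section Homology.
Variables (T : choiceType) (K : scomplex T) (p : nat).

Definition boundaries : pred (cycle K p) :=
  fun z => `[< exists2 b, supported (tuple_in K p.+1) b & bd b = z >].

Fact boundaries_closed : zmod_closed boundaries.
Proof.
split; first by apply/asboolP; exists 0; rewrite ?supported0 ?raddf0.
move=> z z' /asboolP[b Kb bz] /asboolP[b' Kb' bz']; apply/asboolP.
by exists (b - b'); rewrite ?supportedB ?raddfB //= bz bz'.
Qed.
HB.instance Definition _ :=
  GRing.isZmodClosed.Build (cycle K p) boundaries boundaries_closed.

(* The reduced homology group in degree [p]. *)
Definition homology :=
  Quotient.quot (GRing.ZmodClosed.clone (cycle K p) boundaries _).
HB.instance Definition _ := GRing.Zmodule.on homology.
HB.instance Definition _ := ZmodQuotient.on homology.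

(* The class of a chain, meant for cycles; other chains are sent to [0]. *)
Definition class (c : chain T) : homology := \pi_homology (insubd (0 : cycle K p) c).

Definition representative (x : homology) : chain T := val (repr x).

Lemma representative_cycle x : representative x \in cycles K p.
Proof. exact: valP. Qed.

Lemma classK x : class (representative x) = x.
Proof. by rewrite /class valKd reprK. Qed.

Lemma class_eqP c c' : c \in cycles K p -> c' \in cycles K p ->
  (class c = class c') <->
  (exists2 b, supported (tuple_in K p.+1) b & bd b = c - c').
Proof.
move=> Zc Zc'; rewrite /class.
have [z zc] : exists z : cycle K p, val z = c by exists (Cycle Zc).
have [z' zc'] : exists z : cycle K p, val z = c' by exists (Cycle Zc').
rewrite -zc -zc' !valKd; split=> [/eqP|b].
  by rewrite -Quotient.idealrBE => /asboolP[b Kb bz]; exists b.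
by apply/eqP; rewrite -Quotient.idealrBE; apply/asboolP.
Qed.

Lemma classB c c' : c \in cycles K p -> c' \in cycles K p ->
  class (c - c') = class c - class c'.
Proof.
move=> Zc Zc'; rewrite /class.
have [z zc] : exists z : cycle K p, val z = c by exists (Cycle Zc).
have [z' zc'] : exists z : cycle K p, val z = c' by exists (Cycle Zc').
by rewrite -zc -zc' -raddfB !valKd raddfB.
Qed.

Lemma class0 : class 0 = 0.
Proof. by rewrite -[X in class X](subrr 0) classB ?rpred0 // subrr. Qed.
End Homology.

Section Induced.
Variables (T U : choiceType) (K : scomplex T) (L : scomplex U) (p : nat).
Variable f : {additive chain T -> chain U}.

(* The map induced in homology by a chain map [f] from [K] to [L]. *)
Definition induced (x : homology K p) : homology L p :=
  class L p (f (representative x)).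

Lemma inducedE :
  (forall q c, supported (tuple_in K q) c -> supported (tuple_in L q) (f c)) ->
  (forall c, bd (f c) = f (bd c)) ->
  forall c, c \in cycles K p -> induced (class K p c) = class L p (f c).
Proof.
move=> fK fbd.
have fZ c : c \in cycles K p -> f c \in cycles L p.
  by rewrite !inE => /andP[/fK-> /eqP c0]; rewrite fbd c0 raddf0 eqxx.
move=> c Zc; have Zr := representative_cycle (class K p c).
apply/class_eqP; try exact: fZ.
have /class_eqP[//|//|b Kb bE] := classK (class K p c).
by exists (f b); [exact: fK | rewrite fbd bE raddfB].
Qed.
End Induced.

(** * Barycentric subdivision *)

Section Subdivision.
Variable T : choiceType.

(* The poset of simplices of [K], ordered by inclusion, as a complex. *)
Definition sd (K : scomplex T) : scomplex {fset T} :=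
  order_complex (fun X Y : {fset T} => (X `<=` Y)%fset) K.

Fixpoint sd_rec (n : nat) (s : seq T) : chain {fset T} :=
  if n is m.+1 then cone [fset x in s]%fset (fglift (sd_rec m) (bd << s >>))
  else << [::] >>.

(* The subdivision operator: a tuple [s] is sent to the cone with apex its
   barycenter [[fset x in s]] over the subdivision of its boundary. *)
Definition Sd (c : chain T) : chain {fset T} :=
  fglift (fun s => sd_rec (size s) s) c.

HB.instance Definition _ :=
  GRing.isZmodMorphism.Build (chain T) (chain {fset T}) Sd (lift_is_additive _).
End Subdivision.

(** * Direct sums *)

Section DirectSum.
Variables (I : choiceType) (M : I -> zmodType).

Definition finite_support (f : forall i, M i) : bool :=
  `[< exists s : seq I, forall i, i \notin s -> f i = 0 >].

Record dsum := DSum { dsum_fun :> forall i, M i; _ : finite_support dsum_fun }.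

HB.instance Definition _ := [isSub for dsum_fun].
HB.instance Definition _ := gen_eqMixin dsum.
HB.instance Definition _ := gen_choiceMixin dsum.

Lemma dsumP (x y : dsum) : (forall i, x i = y i) -> x = y.
Proof. by move=> xy; apply/val_inj/functional_extensionality_dep. Qed.

Fact dsum0_subproof : finite_support (fun i => 0).
Proof. by apply/asboolP; exists [::]. Qed.

Fact dsumN_subproof (x : dsum) : finite_support (fun i => - x i).
Proof.
case: x => x /= /asboolP[s xs]; apply/asboolP.
by exists s => i /xs->; rewrite oppr0.
Qed.

Fact dsumD_subproof (x y : dsum) : finite_support (fun i => x i + y i).
Proof.
case: x y => [x /= /asboolP[s xs]] [y /= /asboolP[t yt]]; apply/asboolP.
exists (s ++ t) => i; rewrite mem_cat negb_or => /andP[/xs-> /yt->].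
by rewrite addr0.
Qed.

Definition dsum0 := DSum dsum0_subproof.
Definition dsumN x := DSum (dsumN_subproof x).
Definition dsumD x y := DSum (dsumD_subproof x y).

Fact dsumA : associative dsumD.
Proof. by move=> x y z; apply: dsumP => i /=; rewrite addrA. Qed.
Fact dsumC : commutative dsumD.
Proof. by move=> x y; apply: dsumP => i /=; rewrite addrC. Qed.
Fact dsum0l : left_id dsum0 dsumD.
Proof. by move=> x; apply: dsumP => i /=; rewrite add0r. Qed.
Fact dsumNl : left_inverse dsum0 dsumN dsumD.
Proof. by move=> x; apply: dsumP => i /=; rewrite addNr. Qed.

HB.instance Definition _ :=
  GRing.isZmodule.Build dsum dsumA dsumC dsum0l dsumNl.

Definition single_fun (i : I) (x : M i) (j : I) : M j :=
  if i =P j is ReflectT e then ecast k (M k) e x else 0.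

Fact single_subproof i (x : M i) : finite_support (single_fun x).
Proof.
apply/asboolP; exists [:: i] => j; rewrite inE /single_fun.
by case: eqP => // ij /eqP[]; rewrite ij.
Qed.

(* The element [(i, x)] of the direct sum. *)
Definition single i (x : M i) := DSum (single_subproof x).
Arguments single : clear implicits.

Lemma singleE i (x : M i) : single i x i = x.
Proof. by rewrite /= /single_fun; case: eqP => // e; rewrite eq_axiomK. Qed.

Lemma single_neq i j (x : M i) : i != j -> single i x j = 0.
Proof. by rewrite /= /single_fun; case: eqP. Qed.
End DirectSum.
Arguments single {I M} i x.

(** * Quotient vector spaces *)

Section QuotientSpace.
Variables (F : fieldType) (V : vectType F) (L : {vspace V}).

Definition quov := Quotient.quot (GRing.ZmodClosed.clone V (pred_of_vspace L) _).
HB.instance Definition _ := GRing.Zmodule.on quov.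
HB.instance Definition _ := ZmodQuotient.on quov.

Definition quov_pi (v : V) : quov := \pi_quov v.

Lemma quov_eq u v : (quov_pi u = quov_pi v) <-> (u - v \in L).
Proof.
split=> [/eqP|uvL]; first by rewrite -Quotient.idealrBE.
by apply/eqP; rewrite -Quotient.idealrBE.
Qed.

Lemma quov_piK (x : quov) : quov_pi (repr x) = x.
Proof. exact: reprK. Qed.

Fact quov_pi_is_additive : zmod_morphism quov_pi.
Proof. by move=> u v; rewrite /quov_pi raddfB. Qed.
HB.instance Definition _ :=
  GRing.isZmodMorphism.Build V quov quov_pi quov_pi_is_additive.

Definition quov_scale (a : F) (x : quov) : quov := quov_pi (a *: repr x).

Fact quov_scaleE a v : quov_scale a (quov_pi v) = quov_pi (a *: v).
Proof.
by apply/quov_eq; rewrite -scalerBr memvZ //; apply/quov_eq; rewrite quov_piK.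
Qed.

Fact quov_scaleA a b x : quov_scale a (quov_scale b x) = quov_scale (a * b) x.
Proof. by rewrite -[x]quov_piK !quov_scaleE scalerA. Qed.
Fact quov_scale1 : left_id 1 quov_scale.
Proof. by move=> x; rewrite -[x]quov_piK quov_scaleE scale1r. Qed.
Fact quov_scaleDr : right_distributive quov_scale +%R.
Proof.
move=> a x y; rewrite -[x]quov_piK -[y]quov_piK -raddfD !quov_scaleE.
by rewrite scalerDr raddfD.
Qed.
Fact quov_scaleDl x : {morph quov_scale^~ x : a b / a + b}.
Proof. by move=> a b; rewrite -[x]quov_piK !quov_scaleE scalerDl raddfD. Qed.

HB.instance Definition _ := GRing.Zmodule_isLmodule.Build F quov
  quov_scaleA quov_scale1 quov_scaleDr quov_scaleDl.

Fact quov_pi_is_scalable : scalable quov_pi.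
Proof. by move=> a v; rewrite -quov_scaleE. Qed.
HB.instance Definition _ :=
  GRing.isScalable.Build F V quov _ quov_pi quov_pi_is_scalable.


Let coords (v : V) := v2r (vsproj L^C%VS (daddv_pi L^C L v)).

Let coords_linear : linear coords.
Proof. by move=> a u v; rewrite /coords !linearP. Qed.

Let complL0 : (L^C :&: L = 0)%VS.
Proof. by rewrite capvC capv_compl. Qed.

Let coords_vsval r : coords (vsval (r2v r : subvs_of L^C%VS)) = r.
Proof. by rewrite /coords daddv_pi_id ?subvsP // vsvalK r2vK. Qed.

Let coords_eq0 v : (coords v == 0) = (v \in L).
Proof.
have vE : daddv_pi L^C L v + daddv_pi L L^C v = v.
  by rewrite daddv_pi_add // addvC addv_complf memvf.
apply/eqP/idP => [v0|vL].
  rewrite -vE; suff -> : daddv_pi L^C L v = 0 by rewrite add0r memv_pi.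
  rewrite -(vsprojK (memv_pi L^C L v)); move: v0; rewrite /coords.
  by rewrite -[RHS](linear0 v2r) => /v2r_inj->; rewrite linear0.
have : daddv_pi L^C L v \in (L^C :&: L)%VS.
  rewrite memv_cap memv_pi -[daddv_pi L^C L v](addrK (daddv_pi L L^C v)) vE.
  by rewrite memvB // memv_pi.
by rewrite complL0 memv0 /coords => /eqP->; rewrite !linear0.
Qed.

Fact quov_vector_axiom : Vector.axiom (dim (subvs_of L^C%VS)) quov.
Proof.
have coordsB u v : coords (u - v) = coords u - coords v.
  by rewrite /coords !linearB.
have coords_pi v : coords (repr (quov_pi v)) = coords v.
  apply/eqP; rewrite -subr_eq0 -coordsB coords_eq0; apply/quov_eq.
  exact: quov_piK.
exists (fun x => coords (repr x)) => [a x y|].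
  rewrite -[x]quov_piK -[y]quov_piK -linearZ_LR -raddfD !coords_pi.
  exact: coords_linear.
exists (fun r => quov_pi (vsval (r2v r : subvs_of L^C%VS))) => [x|r].
  rewrite -[RHS]quov_piK; apply/quov_eq.
  by rewrite -coords_eq0 coordsB coords_vsval subrr.
by rewrite coords_pi coords_vsval.
Qed.
HB.instance Definition _ := Lmodule_hasFinDim.Build F quov quov_vector_axiom.
End QuotientSpace.

Lemma quov_pi_surj (F : fieldType) (V : vectType F) (L : {vspace V}) :
  limg (linfun (@quov_pi F V L)) = fullv.
Proof.
apply/vspaceP => x; rewrite memvf -[x]quov_piK; apply/memv_imgP.
by exists (repr x); rewrite ?memvf ?lfunE.
Qed.

Lemma quov_pi_lker (F : fieldType) (V : vectType F) (L : {vspace V}) :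
  lker (linfun (@quov_pi F V L)) = L.
Proof.
apply/vspaceP => v; rewrite memv_ker lfunE -[RHS]/(v \in L).
by apply/eqP/idP; rewrite -(raddf0 (@quov_pi F V L)) quov_eq subr0.
Qed.

(** * Steinberg modules *)

Section Steinberg.
Variables (F : fieldType) (V : vectType F).
Implicit Types (l : {vspace V} * {vspace V}) (X : {fset V}).

Definition Estar_simplex X :=
  (X != fset0) && ((0 \in X) ==> (<<X>> != fullv :> {vspace V})%VS).

Fact Estar_simplex_neq0 X : Estar_simplex X -> X != fset0.
Proof. by case/andP. Qed.

Fact Estar_simplex_sub X Y :
  Estar_simplex X -> (Y `<=` X)%fset -> Y != fset0 -> Estar_simplex Y.
Proof.
case/andP=> _ /implyP EX /fsubsetP YX Y0; rewrite /Estar_simplex Y0 /=.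
apply/implyP => /YX/EX; apply: contraNneq => YV.
by rewrite eqEsubv subvf -YV sub_span.
Qed.

Definition Estar := SComplex Estar_simplex_neq0 Estar_simplex_sub.

Definition layer_le l l' :=
  [&& (l'.1 <= l.1)%VS, (l.1 <= l.2)%VS & (l.2 <= l'.2)%VS].

Definition proper_layer l := (l.1 <= l.2)%VS && (l != (0%VS, fullv)).

(* The posets [J(V)] and [J(V)_{<l}], as complexes. *)
Definition J := order_complex layer_le proper_layer.

Definition J_below l :=
  order_complex layer_le [pred x | [&& proper_layer x, layer_le x l & x != l]].

(* [(X_0 < ... < X_p) |-> (<X_0>, <X_p>)] *)
Definition chain_layer (C : {fset {fset V}}) : {vspace V} * {vspace V} :=
  let C' := sort (fun X Y : {fset V} => X `<=` Y)%fset C in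
  (<<head fset0 C'>>%VS, <<last fset0 C'>>%VS).

(* The identification of the homology of [E^*(V)] with that of [J(V)]: the
   poset of chains of simplices of [E^*(V)] is the poset of simplices of its
   subdivision, so its order complex is the second subdivision of [E^*(V)]. *)
Definition Estar_to_J p : homology Estar p -> homology J p :=
  induced J (push chain_layer \o @Sd _ \o @Sd _).

Definition St := homology J (\dim {:V}).-1.

(* The class of [d(0, g_1, ..., g_m)] for a sequence [g] of [m = dim V] vectors. *)
Definition symbol (g : seq V) : St :=
  Estar_to_J (class Estar _ (bd << 0 :: g >>)).

(* The same, read as [0] when [g] does not span [V]. *)
Definition symbol_or0 (g : seq V) : St :=
  if (<<g>> == fullv)%VS then symbol g else 0.
End Steinberg.

(** * The map [d^1] on coefficients *)

Section D1.
Variables (F : fieldType) (V : vectType F).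
Implicit Types (l : {vspace V} * {vspace V}).

Definition hyperplane := {W : {vspace V} | \dim W == (\dim {:V}).-1}.
Definition line := {L : {vspace V} | \dim L == 1}.

(* The isomorphisms of [J(V)_{<(0,W)}] with [J(W)] and of [J(V)_{<(L,V)}]
   with [J(V/L)]. *)
Definition sub_layer (W : {vspace V}) l :
    {vspace subvs_of W} * {vspace subvs_of W} :=
  ((linfun (@vsval _ _ W) @^-1: l.1)%VS, (linfun (@vsval _ _ W) @^-1: l.2)%VS).

Definition quo_layer (L : {vspace V}) l : {vspace quov L} * {vspace quov L} :=
  ((linfun (@quov_pi _ _ L) @: l.1)%VS, (linfun (@quov_pi _ _ L) @: l.2)%VS).

Definition target : zmodType :=
  (dsum (fun W : hyperplane => St (subvs_of (val W))) *
   dsum (fun L : line => St (quov (val L))))%type.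

(* Write a cycle [z] of [J(V)] as [z_1 + z_2], with [z_2] the sum, over the
   layers [l] of dimension [n - 1], of the parts of [z] on the tuples through
   [l]; these lie in the cone over [J(V)_{<l}].  The [l]-component of the
   boundary map is the class of [- d z_2]. *)
Definition mv_boundary l (z : chain ({vspace V} * {vspace V})) := - bd (part l z).

Definition d1_sub (z : chain ({vspace V} * {vspace V})) (W : hyperplane) :
    St (subvs_of (val W)) :=
  class _ _ (push (sub_layer (val W)) (mv_boundary (0%VS, val W) z)).

Definition d1_quo (z : chain ({vspace V} * {vspace V})) (L : line) :
    St (quov (val L)) :=
  class _ _ (push (quo_layer (val L)) (mv_boundary (val L, fullv) z)).

Lemma part_notin (T : choiceType) (x : T) (c : chain T) :
  x \notin flatten (dom c) -> part x c = 0.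
Proof.
move=> xc; rewrite /part fgliftE big_seq big1 // => s sc.
case: ifP => [xs|]; last by rewrite scaler0.
by case/flattenP: xc; exists s.
Qed.

Fact d1_sub_finite z : finite_support (d1_sub z).
Proof.
apply/asboolP; exists (pmap (fun l => insub l.2) (flatten (dom z))) => W Wz.
rewrite /d1_sub /mv_boundary part_notin ?raddf0 ?class0 //.
apply: contra Wz => Wz; rewrite mem_pmap; apply/mapP.
by exists (0%VS, val W); rewrite // valK.
Qed.

Fact d1_quo_finite z : finite_support (d1_quo z).
Proof.
apply/asboolP; exists (pmap (fun l => insub l.1) (flatten (dom z))) => L Lz.
rewrite /d1_quo /mv_boundary part_notin ?raddf0 ?class0 //.
apply: contra Lz => Lz; rewrite mem_pmap; apply/mapP.
by exists (val L, fullv); rewrite // valK.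
Qed.

Definition d1 (x : St V) : target :=
  let z := representative x in (DSum (d1_sub_finite z), DSum (d1_quo_finite z)).

(* [((0, W), d(0, g_1, ..., g_{n-1}))] for [g] in the space [W]; this is [0]
   unless [dim W = n - 1]. *)
Definition at_sub (W : {vspace V}) (g : seq V) : target :=
  if insub W : option hyperplane is Some W' then
    (single W' (symbol_or0 [seq vsproj (val W') v | v <- g]), 0)
  else 0.

(* [((L, V), d(0, g'_1, ..., g'_{n-1}))], with [g'] the image of [g] in [V/L]. *)
Definition at_quo (L : {vspace V}) (g : seq V) : target :=
  if insub L : option line is Some L' then
    (0, single L' (symbol_or0 [seq quov_pi (val L') v | v <- g]))
  else 0.
End D1.

(** * Modules over a domain *)

Section Modules.
Variable A : idomainType.

Definition ideal (I : A -> Prop) :=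
  [/\ I 0, forall x y, I x -> I y -> I (x + y) & forall a x, I x -> I (a * x)].

Definition noetherian :=
  forall I : A -> Prop, ideal I ->
  exists s : seq A, forall x,
    I x <-> exists c : 'I_(size s) -> A, x = \sum_i c i * s`_i.

Definition finitely_generated (d : lmodType A) :=
  exists s : seq d, forall x, exists c : 'I_(size s) -> A, x = \sum_i c i *: s`_i.

Definition torsion_free (d : lmodType A) :=
  forall (a : A) (x : d), a *: x = 0 -> a = 0 \/ x = 0.

(* [A]-linear maps from [d] to a vector space over the fraction field of [A]. *)
Definition semilin (d : lmodType A) (V : lmodType {fraction A}) :=
  {linear d -> V | (@FracField.tofrac A) \; *:%R}.

(* [V], together with [i], is the base change of [d] to the fraction field. *)
Definition is_base_change (d : lmodType A) (V : lmodType {fraction A})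
    (i : semilin d V) :=
  forall (U : lmodType {fraction A}) (f : semilin d U),
  exists2 h : {linear V -> U}, h \o i =1 f &
    forall h' : {linear V -> U}, h' \o i =1 f -> h' =1 h.
End Modules.

(** * Well-definedness *)

Lemma mem_fset_seq (T : choiceType) (s : seq T) : [fset x in s]%fset =i s.
Proof. by move=> x; rewrite in_fset. Qed.

Lemma mem_omit (T : eqType) i (s : seq T) : {subset omit i s <= s}.
Proof. by move=> x; rewrite mem_cat => /orP[/mem_take|/mem_drop]. Qed.

Lemma size_omit (T : Type) i (s : seq T) :
  (i < size s)%N -> size (omit i s) = (size s).-1.
Proof.
move=> si; rewrite size_cat size_take si size_drop.
by case: (size s) si => // n; rewrite ltnS subSS => /subnKC.
Qed.

Lemma tuple_in_omit (T : choiceType) (K : scomplex T) p s i :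
  tuple_in K p.+1 s -> (i < size s)%N -> tuple_in K p (omit i s).
Proof.
case/andP=> /eqP sp Ks si; have so : size (omit i s) = p.+1.
  by rewrite size_omit // sp.
rewrite /tuple_in so eqxx /=; apply: simplex_sub Ks _ _.
  apply/fsubsetP => x; rewrite !mem_fset_seq; exact: mem_omit.
case: (omit i s) so => // x t _; apply/fset0Pn; exists x.
by rewrite mem_fset_seq mem_head.
Qed.

Lemma tuple_in_order (T : choiceType) (r : rel T) (D : pred T) p s :
  tuple_in (order_complex r D) p s =
  [&& size s == p.+1, all D s & all2rel (fun x y => r x y || r y x) s].
Proof.
rewrite /tuple_in /= /order_simplex; case: eqP => //= sp.
have -> : [fset x in s]%fset != fset0.
  case: s sp => // x s _; apply/fset0Pn; exists x.
  by rewrite mem_fset_seq mem_head.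
have sE := mem_fset_seq s.
rewrite /= (eq_all_r sE); congr (_ && _).
by apply/allrelP/allrelP => H x y xs ys; apply: H; rewrite ?sE // -sE.
Qed.

Lemma push_supported (T U : choiceType) (f : T -> U) (P : pred (seq T))
    (Q : pred (seq U)) (c : chain T) :
  (forall s, P s -> Q (map f s)) -> supported P c -> supported Q (push f c).
Proof. by move=> PQ; apply: supported_lift => s /PQ; rewrite supportedU. Qed.

Section SubdivisionTheory.
Variable T : choiceType.
Implicit Types (s : seq T) (c : chain T).

Lemma SdU s : Sd << s >> = sd_rec (size s) s.
Proof. exact: fgliftU. Qed.

Lemma supported_size n c :
  supported (fun s => size s == n) c -> Sd c = fglift (sd_rec n) c.
Proof.
move=> /allP cn; rewrite /Sd !fgliftE big_seq [RHS]big_seq.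
by apply: eq_bigr => s /cn/eqP->.
Qed.

Lemma SdE x s : Sd << x :: s >> = cone [fset y in x :: s]%fset (Sd (bd << x :: s >>)).
Proof.
rewrite SdU /=; congr cone; apply/esym/supported_size.
rewrite bdU; apply: supported_sum => i _; apply: supportedZ.
by rewrite supportedU size_omit.
Qed.

Lemma bd_Sd c : bd (Sd c) = Sd (bd c).
Proof.
apply: (chain_ext (f := @bd _ \o @Sd T) (g := @Sd T \o @bd T)) c => s /=.
have [n] := ubnP (size s); elim: n s => // n IHn [|x s] sn.
  by rewrite bd_nil raddf0 SdU bd_nil.
rewrite SdE bd_cone.
suff -> : bd (Sd (bd << x :: s >>)) = 0 by rewrite raddf0 subr0.
transitivity (Sd (bd (bd << x :: s >>))); last by rewrite bdK raddf0.
rewrite bdU !raddf_sum; apply: eq_bigr => i _.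
by rewrite !raddf_scalez /= IHn // size_omit.
Qed.

Lemma Sd_supported (K : scomplex T) p c :
  supported (tuple_in K p) c -> supported (tuple_in (sd K) p) (Sd c).
Proof.
pose Q s := fun t : seq {fset T} => [&& size t == size s,
  all (fun X => (X != fset0) && (X `<=` [fset x in s])%fset) t &
  all2rel (fun X Y => (X `<=` Y) || (Y `<=` X))%fset t].
have SdQ s : supported (Q s) (Sd << s >>).
  have [n] := ubnP (size s); elim: n s => // n IHn [|x s] sn.
    by rewrite SdU supportedU /Q /=.
  rewrite SdE bdU raddf_sum.
  pose Q' := fun t : seq {fset T} => [&& size t == size s,
    all (fun X => (X != fset0) && (X `<=` [fset y in x :: s])%fset) t &
    all2rel (fun X Y => (X `<=` Y) || (Y `<=` X))%fset t].
  apply: (supported_lift (P := Q')) => [t /and3P[ts /allP tP /allrelP tc]|].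
    rewrite supportedU /Q /= eqSS ts fsubset_refl /= andbT -andbA; apply/and3P; split.
    - by apply/fset0Pn; exists x; rewrite mem_fset_seq mem_head.
    - exact/allP.
    apply/allrelP => X Y; rewrite !inE => /predU1P[->|Xt] /predU1P[->|Yt].
    - by rewrite fsubset_refl.
    - by have /andP[_ ->] := tP _ Yt; rewrite orbT.
    - by have /andP[_ ->] := tP _ Xt.
    - exact: tc.
  apply: supported_sum => i _; rewrite raddf_scalez; apply: supportedZ.
  have so : size (omit i (x :: s)) = size s by rewrite size_omit.
  have so' : (size (omit i (x :: s)) < n)%N by rewrite so.
  apply: supported_sub (IHn _ so') => t /and3P[]; rewrite so => ts tP tc.
  apply/and3P; split=> //; apply: sub_all tP => X /andP[-> Xs] /=.
  apply: fsubset_trans Xs _; apply/fsubsetP => y; rewrite !mem_fset_seq.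
  exact: mem_omit.
rewrite -/(supported _ _); apply: supported_lift => s /andP[/eqP sp Ks].
rewrite -SdU; apply: supported_sub (SdQ s) => t /and3P[ts tP tc].
rewrite tuple_in_order -sp ts tc andbT /=; apply: sub_all tP => X /andP[X0 Xs].
exact: simplex_sub Ks Xs X0.
Qed.
End SubdivisionTheory.

Section SteinbergTheory.
Variables (F : fieldType) (V : vectType F).

Lemma sort_chain (T : choiceType) (C : {fset {fset T}}) :
    C != fset0 -> all2rel (fun X Y => (X `<=` Y) || (Y `<=` X))%fset C ->
  let C' := sort (fun X Y : {fset T} => X `<=` Y)%fset C in
  [/\ head fset0 C' \in C, last fset0 C' \in C,
      forall X, X \in C -> (head fset0 C' `<=` X)%fset &
      forall X, X \in C -> (X `<=` last fset0 C')%fset].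
Proof.
move=> C0 /allrelP Ct C'.
have CE : C' =i C by move=> X; rewrite mem_sort.
have C'0 : (0 < size C')%N.
  by case/fset0Pn: C0 => X; rewrite -CE; case: (C').
have Cs : sorted (fun X Y : {fset T} => X `<=` Y)%fset C'.
  by apply: (sort_sorted_in (P := mem C)) => //; apply/allP.
have C'n : forall i j, (i <= j)%N -> (j < size C')%N ->
    (nth fset0 C' i `<=` nth fset0 C' j)%fset.
  move=> i j ij jC.
  apply: (sorted_leq_nth (@fsubset_trans _) (@fsubset_refl _)) => //.
  by rewrite inE (leq_ltn_trans ij).
rewrite -nth0 -nth_last -!CE; split.
- by rewrite mem_nth.
- by rewrite mem_nth // prednK.
- move=> X; rewrite -CE => XC; rewrite -(nth_index fset0 XC).
  by rewrite C'n // index_mem.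
- move=> X; rewrite -CE => XC; rewrite -(nth_index fset0 XC).
  by rewrite C'n ?prednK // -ltnS prednK // index_mem.
Qed.

Lemma chain_layer_tuple p (s : seq {fset {fset V}}) :
  tuple_in (sd (sd (Estar V))) p s -> tuple_in (J V) p (map (@chain_layer _ V) s).
Proof.
rewrite !tuple_in_order size_map => /and3P[-> /allP sC /allrelP st] /=.
apply/andP; split.
  apply/allP => _ /mapP[C /sC /and3P[C0 /allP CE Ct] ->].
  have [hC lC hle _] := sort_chain C0 Ct.
  have hl := hle _ lC; rewrite /proper_layer /chain_layer /=.
  rewrite sub_span; last exact/fsubsetP.
  apply/eqP => -[h0 lV].
  have /andP[lN /implyP l0] := CE _ lC; have /andP[hN _] := CE _ hC.
  case/fset0Pn: hN => v vh.
  have := memv_span vh; rewrite h0 memv0 => /eqP v0.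
  by move: vh; rewrite v0 => /(fsubsetP hl)/l0; rewrite lV eqxx.
have le_layer C D : C \in s -> D \in s -> (C `<=` D)%fset ->
    layer_le (@chain_layer _ V C) (@chain_layer _ V D).
  move=> /sC/and3P[C0 _ Ct] /sC/and3P[D0 _ Dt] CD.
  have [hC lC hCl lCl] := sort_chain C0 Ct.
  have [hD lD hDl lDl] := sort_chain D0 Dt.
  apply/and3P; split; apply: sub_span; apply/fsubsetP.
  - exact/hDl/(fsubsetP CD).
  - exact: hCl.
  - exact/lDl/(fsubsetP CD).
apply/allrelP => _ _ /mapP[C Cs ->] /mapP[D Ds ->].
by apply/orP; case/orP: (st _ _ Cs Ds) => ?; [left | right]; apply: le_layer.
Qed.

Lemma Estar_to_JE p c : c \in cycles (Estar V) p ->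
  Estar_to_J (class _ p c) = class (J V) p (push (@chain_layer _ V) (Sd (Sd c))).
Proof.
move=> Zc; rewrite /Estar_to_J inducedE //=; last first.
  by move=> b; rewrite bd_push !bd_Sd.
move=> q b Kb /=.
  apply: push_supported; first exact: chain_layer_tuple.
  exact/Sd_supported/Sd_supported.
Qed.

Lemma symbol_cycle (g : seq V) : (0 < \dim {:V})%N -> size g = \dim {:V} ->
  bd << 0 :: g >> \in cycles (Estar V) (\dim {:V}).-1.
Proof.
move=> V0 gV; rewrite inE bdK eqxx andbT bd_cons.
have inE' s : (0 < size s)%N ->
    tuple_in (Estar V) (size s).-1 s = ((0 \in s) ==> (<<s>> != fullv :> {vspace V})%VS).
  case: s => // x s _; rewrite /tuple_in eqxx /= /Estar_simplex mem_fset_seq.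
  have -> : (<<[fset x0 | x0 in x :: s]%fset>> = <<x :: s>> :> {vspace V})%VS.
    by apply/eq_span => v; rewrite mem_fset_seq.
  by rewrite andb_idl // => _; apply/fset0Pn; exists x; rewrite mem_fset_seq mem_head.
have small s : (size s < \dim {:V})%N -> (<<s>> != fullv :> {vspace V})%VS.
  by apply: contraTneq => <-; rewrite -leqNgt dim_span.
apply: supportedB.
  rewrite supportedU -gV inE' ?gV //; apply/implyP => g0.
  have -> : (<<g>> = <<rem 0%R g>> :> {vspace V})%VS.
    rewrite -[RHS]add0v -span_cons; apply: eq_span; apply: perm_mem.
    exact: perm_to_rem.
  by rewrite small // size_rem // gV prednK.
rewrite bdU raddf_sum; apply: supported_sum => i _.
rewrite raddf_scalez /= coneU; apply: supportedZ; rewrite supportedU.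
have so : size (omit i g) = (size g).-1 by rewrite size_omit.
have -> : (\dim {:V}).-1 = (size (0%R :: omit i g)).-1 by rewrite /= so gV.
rewrite inE' //; apply/implyP => _; rewrite span_cons add0v small // so gV.
by rewrite prednK.
Qed.

Lemma symbolE (g : seq V) : (0 < \dim {:V})%N -> size g = \dim {:V} ->
  symbol g = class (J V) _ (push (@chain_layer _ V) (Sd (Sd (bd << 0 :: g >>)))).
Proof. by move=> V0 gV; rewrite /symbol Estar_to_JE // symbol_cycle. Qed.
End SteinbergTheory.

Section D1Theory.
Variables (F : fieldType) (V : vectType F).
Implicit Types (l x : {vspace V} * {vspace V}).
Implicit Types (c z : chain ({vspace V} * {vspace V})).

Definition maximal_layer l :=
  forall x, proper_layer x -> layer_le l x -> x = l.

Lemma maximal_sub (W : {vspace V}) :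
  \dim W = (\dim {:V}).-1 -> maximal_layer (0%VS, W).
Proof.
move=> dW [X Y] /andP[/= XY XYN] /and3P[/=]; rewrite subv0 => /eqP X0 _ WY.
subst X; have YN : Y != fullv by apply: contraNneq XYN => ->.
congr (_, _); apply/esym/eqP; rewrite eqEdim WY dW -ltnS.
have : (\dim Y < \dim {:V})%N.
  by rewrite ltnNge; apply: contra YN => YV; rewrite eqEdim subvf.
by case: (\dim {:V}).
Qed.

Lemma maximal_quo (L : {vspace V}) : \dim L = 1%N -> maximal_layer (L, fullv).
Proof.
move=> dL [X Y] /andP[/= XY XYN] /and3P[/= XL _ VY].
have YV : Y = fullv by apply/eqP; rewrite eqEsubv subvf VY.
subst Y; congr (_, _); apply/eqP; rewrite eqEdim XL dL lt0n dimv_eq0.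
by apply: contraNneq XYN => ->.
Qed.

Lemma part_eq0 l c : supported (fun s => l \notin s) c -> part l c = 0.
Proof.
move=> /allP lc; rewrite /part fgliftE big_seq big1 // => s /lc /negPf->.
by rewrite scaler0.
Qed.

Lemma subr_part l c :
  c - part l c =
  fglift (fun s : seq ({vspace V} * {vspace V}) =>
            if l \in s then 0 else << s >> : chain _) c.
Proof.
rewrite -{1}[c]freeg_sumE /part !fgliftE -sumrB; apply: eq_bigr => s _.
have -> : << coeff s c *g s >> = coeff s c *: << s >>
    :> chain ({vspace V} * {vspace V}).
  by rewrite -[X in _ = X *: _]intz scaler_int freegU_mulz intz.
by case: ifP; rewrite ?scaler0 ?subrr ?subr0.
Qed.

Lemma part_bd l c : part l (bd (part l c)) = part l (bd c).
Proof.
apply/esym/eqP; rewrite -subr_eq0 -!raddfB /=; apply/eqP/part_eq0.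
rewrite subr_part; apply: (supported_bd (P := fun s => l \notin s)).
  by move=> s i; move=> ls _; apply: contra ls; apply: mem_omit.
apply: (supported_lift (P := predT)); last exact/all_predT.
by move=> s _; case: ifPn => ls; rewrite ?supported0 ?supportedU.
Qed.

Lemma bd_part_below l q c : maximal_layer l ->
  supported (tuple_in (J V) q.+1) c ->
  supported (tuple_in (J_below l) q) (bd (part l c) - part l (bd c)).
Proof.
move=> lmax Jc; pose le_l := all (fun x => layer_le x l).
have : supported [pred s | tuple_in (J V) q.+1 s & le_l s] (part l c).
  apply: supported_lift Jc => s Js; case: ifP => ls; last exact: supported0.
  rewrite supportedU /= Js; apply/allP => x xs.
  move: Js; rewrite tuple_in_order => /and3P[_ /allP sJ /allrelP sc].
  case/orP: (sc _ _ xs ls) => // lx.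
  by have xl := lmax _ (sJ _ xs) lx; move: lx; rewrite xl.
move=> /(supported_bd (Q := [pred s | tuple_in (J V) q s & le_l s])) Jp.
rewrite -part_bd subr_part; apply: supported_lift (Jp _) => [s /andP[Js ls]|].
  case: ifPn => lNs; first exact: supported0; rewrite supportedU.
  move: Js; rewrite !tuple_in_order => /and3P[-> /allP sJ ->] /=.
  rewrite andbT; apply/allP => x xs /=; rewrite [proper_layer _]sJ //.
  by rewrite (allP ls) //=; apply: contraNneq lNs => <-.
move=> s i /andP[Js /allP ls] si; rewrite /= tuple_in_omit //=.
by apply/allP => x /mem_omit/ls.
Qed.

Lemma mv_boundary_cycle l p z : maximal_layer l ->
  z \in cycles (J V) p.+1 -> mv_boundary l z \in cycles (J_below l) p.
Proof.
move=> lmax; rewrite !inE => /andP[Jz /eqP z0]; rewrite raddfN /= bdK oppr0 eqxx.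
have := bd_part_below lmax Jz; rewrite z0 raddf0 subr0.
by rewrite supportedN => ->.
Qed.

Lemma mv_boundary_bd l p b : maximal_layer l ->
  supported (tuple_in (J V) p.+2) b ->
  exists2 e, supported (tuple_in (J_below l) p.+1) e & bd e = mv_boundary l (bd b).
Proof.
move=> lmax Jb; exists (bd (part l b) - part l (bd b)).
  exact: bd_part_below.
by rewrite raddfB /= bdK sub0r.
Qed.

Lemma sub_layer_tuple p (W : {vspace V}) s :
  tuple_in (J_below (0%VS, W)) p s ->
  tuple_in (J (subvs_of W)) p (map (sub_layer W) s).
Proof.
pose f := linfun (@vsval _ _ W).
have fW : (limg f = W)%VS.
  apply/vspaceP => v; apply/memv_imgP/idP => [[u _ ->]|vW].
    by rewrite lfunE subvsP.
  by exists (vsproj W v); rewrite ?memvf // lfunE /= vsprojK.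
rewrite !tuple_in_order size_map => /and3P[-> /allP sD /allrelP st] /=.
have le_sub x y : layer_le x y -> layer_le (sub_layer W x) (sub_layer W y).
  by case/and3P=> *; apply/and3P; split; apply: lpreimS.
apply/andP; split; last first.
  apply/allrelP => _ _ /mapP[x xs ->] /mapP[y ys ->].
  by case/orP: (st _ _ xs ys) => ?; apply/orP; [left | right]; apply: le_sub.
apply/allP => _ /mapP[[X Y] /sD/and3P[/andP[/= XY _] /and3P[/= _ _ YW] N] ->].
rewrite /proper_layer /= lpreimS //=; apply: contra N => /eqP E.
have X0 : (f @^-1: X = 0)%VS := congr1 fst E.
have YV : (f @^-1: Y = fullv)%VS := congr1 snd E.
have XE : (f @: (f @^-1: X) = X)%VS by rewrite lpreimK // fW (subv_trans XY).
have YE : (f @: (f @^-1: Y) = Y)%VS by rewrite lpreimK // fW.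
by rewrite -XE X0 limg0 -YE YV fW.
Qed.

Lemma quo_layer_tuple p (L : {vspace V}) s :
  tuple_in (J_below (L, fullv)) p s ->
  tuple_in (J (quov L)) p (map (quo_layer L) s).
Proof.
pose f := linfun (@quov_pi _ _ L).
rewrite !tuple_in_order size_map => /and3P[-> /allP sD /allrelP st] /=.
have le_quo x y : layer_le x y -> layer_le (quo_layer L x) (quo_layer L y).
  by case/and3P=> *; apply/and3P; split; apply: limgS.
apply/andP; split; last first.
  apply/allrelP => _ _ /mapP[x xs ->] /mapP[y ys ->].
  by case/orP: (st _ _ xs ys) => ?; apply/orP; [left | right]; apply: le_quo.
apply/allP => _ /mapP[[X Y] /sD/and3P[/andP[/= XY _] /and3P[/= LX _ _] N] ->].
rewrite /proper_layer /= limgS //=; apply: contra N => /eqP E.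
have X0 : (f @: X = 0)%VS := congr1 fst E.
have YV : (f @: Y = fullv)%VS := congr1 snd E.
have XL : (X <= L)%VS.
  by apply/subvP => v /(memv_img f); rewrite X0 memv0 -memv_ker quov_pi_lker.
have LY := subv_trans LX XY.
apply/eqP; congr (_, _); apply/eqP; first by rewrite eqEsubv XL.
rewrite eqEsubv subvf /=; apply/subvP => v _.
have /memv_imgP[u uY] : quov_pi L v \in (f @: Y)%VS by rewrite YV memvf.
rewrite lfunE /= => /quov_eq/(subvP LY) vu.
by rewrite -(subrK u v) memvD.
Qed.

Lemma dim_quov (L : {vspace V}) :
  \dim {:quov L} = (\dim {:V} - \dim L)%N.
Proof.
rewrite -(quov_pi_surj L) -(limg_ker_dim (linfun (@quov_pi _ _ L)) {:V}).
by rewrite quov_pi_lker capfv addKn.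
Qed.

Lemma dim_subvs (W : {vspace V}) : \dim {:subvs_of W} = \dim W.
Proof. by rewrite dimvf. Qed.

Lemma class_push (T : choiceType) (L : scomplex T)
    (f : {vspace V} * {vspace V} -> T) l n p c c' b :
  n = p.+1 -> maximal_layer l ->
  (forall q s, tuple_in (J_below l) q s -> tuple_in L q (map f s)) ->
  c \in cycles (J V) n -> c' \in cycles (J V) n ->
  supported (tuple_in (J V) n.+1) b -> bd b = c - c' ->
  class L p (push f (mv_boundary l c)) = class L p (push f (mv_boundary l c')).
Proof.
move=> -> lmax fL Zc Zc' Jb bE.
have fZ a : a \in cycles (J V) p.+1 -> push f (mv_boundary l a) \in cycles L p.
  move=> /(mv_boundary_cycle lmax); rewrite !inE => /andP[Ka /eqP a0].
  by rewrite bd_push a0 raddf0 eqxx andbT; apply: push_supported Ka => s /fL.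
apply/class_eqP; rewrite ?fZ //.
have [e Ke eE] := mv_boundary_bd lmax Jb.
exists (push f e); first by apply: push_supported Ke => s /fL.
rewrite bd_push eE bE /mv_boundary -raddfB /=; congr push.
by rewrite (raddfB (part l)) /= (raddfB (@bd _)) /= opprD.
Qed.

(* [d1] may be computed on any cycle representing a class. *)
Lemma d1E z : (1 < \dim {:V})%N -> z \in cycles (J V) (\dim {:V}).-1 ->
  d1 (class (J V) _ z : St V) = (DSum (d1_sub_finite z), DSum (d1_quo_finite z)).
Proof.
move=> V1 Zz; pose x : St V := class (J V) _ z; have Zr := representative_cycle x.
have [b Jb bE] := (class_eqP Zr Zz).1 (classK x).
congr (_, _); apply: dsumP => U; have /eqP dU := valP U.
  have pE : (\dim {:V}).-1 = (\dim {:subvs_of (val U)}).-1.+1.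
    by rewrite dim_subvs dU prednK // -ltnS prednK // ltnW.
  apply: class_push pE _ _ Zr Zz Jb bE; first exact: maximal_sub.
  by move=> q s; apply: sub_layer_tuple.
have pE : (\dim {:V}).-1 = (\dim {:quov (val U)}).-1.+1.
  by rewrite dim_quov dU subn1 prednK // -ltnS prednK // ltnW.
apply: class_push pE _ _ Zr Zz Jb bE; first exact: maximal_quo.
by move=> q s; apply: quo_layer_tuple.
Qed.
End D1Theory.

(* Main.v *)
(* Let [z] be the image in [J(V)] of the second subdivision of the cycle
   [bd (0, g_1, ..., g_n)], split along the faces of [(0, g_1, ..., g_n)], and
   let [y] be the piece coming from one face.  Then [- bd (part l y)] and
   [- bd y] differ by the boundary of [y - part l y], so they are homologous as
   soon as [y - part l y] lives in the target complex.  For [l = (0, W)] only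
   the faces [(0, g_1, .., omit i, .., g_n)] spanning [W] meet [l], and all their
   layers lie below [l].  For [l = (L, V)] only the face [(g_1, ..., g_n)] meets
   [l]; since its layers [(X, Y)] have [X <> 0], [l] is the only one of them
   that becomes improper in [V/L].  What remains is the symbol of the tuple with
   [0] at position [i], and moving [0] to the front costs the sign [(-1)^i]. *)
From HB Require Import structures.
From mathcomp Require Import all_boot all_order all_algebra.
From mathcomp Require Import boolp finmap.
From mathcomp.multinomials Require Import freeg.
Require Import Defs.

Set Implicit Arguments.
Unset Strict Implicit.
Unset Printing Implicit Defensive.

Import GRing.Theory.
Local Open Scope ring_scope.

(** * Homology classes and push-forwards of chains *)

Lemma class_sum (T : choiceType) (K : scomplex T) p (I : finType) (P : pred I)
    (c : I -> chain T) (k : I -> int) :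
  (forall i, P i -> c i \in cycles K p) ->
  class K p (\sum_(i | P i) c i *~ k i) = \sum_(i | P i) class K p (c i) *~ k i.
Proof.
(* [class] is additive only on cycles, as [insubd] sends other chains to 0; the sum is therefore
   formed in [cycle]. *)
move=> Zc; pose z i : cycle K p := insubd 0 (c i).
have -> : \sum_(i | P i) c i *~ k i = val (\sum_(i | P i) z i *~ k i).
  rewrite raddf_sum; apply: eq_bigr => i /Zc Zi.
  by rewrite raddfMz /= -[cycle_val _]/(val _) insubdK.
rewrite /class valKd raddf_sum; apply: eq_bigr => i _.
by rewrite raddfMz.
Qed.

Lemma classMz (T : choiceType) (K : scomplex T) p c k :
  c \in cycles K p -> class K p (c *~ k) = class K p c *~ k.
Proof.
move=> Zc; have := class_sum (I := 'I_1) (P := predT) (fun=> k) (fun _ _ => Zc).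
by rewrite !big_ord1.
Qed.

Lemma classN (T : choiceType) (K : scomplex T) p c :
  c \in cycles K p -> class K p (- c) = - class K p c.
Proof. by move=> Zc; rewrite -[- c]sub0r classB ?rpred0 // class0 sub0r. Qed.

(** Boundaries of supported chains are supported cycles, so being a cycle transfers from [c'] to [c]
    and is checked on one side only. *)
Lemma class_homologous (T : choiceType) (K : scomplex T) p c c' b :
  c' \in cycles K p -> supported (tuple_in K p.+1) b -> c - c' = bd b ->
  c \in cycles K p /\ class K p c = class K p c'.
Proof.
move=> Zc' Kb cE; have Zc : c \in cycles K p.
  rewrite -(subrK c' c) cE rpredD // inE bdK eqxx andbT.
  by apply: supported_bd Kb => s i; apply: tuple_in_omit.
by split=> //; apply/class_eqP => //; exists b.
Qed.

Lemma eq_push (T U : choiceType) (f h : T -> U) (c : chain T) :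
  supported (all (fun x => f x == h x)) c -> push f c = push h c.
Proof.
move=> /allP fh; rewrite /push !fgliftE big_seq [RHS]big_seq.
apply: eq_bigr => s /fh/allP sE; congr (_ *: << _ >>).
by apply/eq_in_map => x /sE/eqP.
Qed.

Lemma push_comp (T U S : choiceType) (f : U -> S) (h : T -> U) (c : chain T) :
  push f (push h c) = push (f \o h) c.
Proof.
apply: (chain_ext (f := push f \o push h) (g := push (f \o h))) c => s /=.
by rewrite !pushU map_comp.
Qed.

Lemma push_cone (T U : choiceType) (f : T -> U) b (c : chain T) :
  push f (cone b c) = cone (f b) (push f c).
Proof.
apply: (chain_ext (f := push f \o cone b) (g := cone (f b) \o push f)) c => s /=.
by rewrite coneU !pushU coneU.
Qed.

(** * Naturality of barycentric subdivision *)

Section SubdivisionNaturality.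
Variables (T U : choiceType) (f : T -> U).

Definition img (X : {fset T}) : {fset U} := (f @` X)%fset.

Lemma img_seq s : img [fset x in s]%fset = [fset x in map f s]%fset.
Proof.
apply/fsetP => y; rewrite mem_fset_seq; apply/imfsetP/mapP => -[x /= xs ->];
  by exists x; rewrite // mem_fset_seq in xs *.
Qed.

(** Induction on the length: both sides are cones with the same apex, by [img_seq], over subdivided
    boundaries. Ordered tuples may repeat entries, so non-injective [f] are covered. *)
Lemma push_Sd (c : chain T) : push img (Sd c) = Sd (push f c).
Proof.
apply: (chain_ext (f := push img \o @Sd T) (g := @Sd U \o push f)) c => s /=.
have [n] := ubnP (size s); elim: n s => // n IHn [|x s] sn.
  by rewrite pushU !SdU pushU.
rewrite pushU [map f _]/= !SdE push_cone img_seq; congr cone.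
rewrite -[f x :: _]/(map f (x :: s)) -pushU bd_push bdU !raddf_sum.
apply: eq_bigr => i _; rewrite !raddf_scalez /= IHn //.
by rewrite size_omit.
Qed.
End SubdivisionNaturality.

(** * Flags of faces in a second subdivision *)

Section Flags.
Variable T : choiceType.
Implicit Types (C : {fset {fset T}}) (s : seq T).

(** These are the vertices of a second subdivision. Totality makes the sorted list in [chain_layer]
    increasing, so that its ends are the extremes of [C]. *)
Definition flag C :=
  (C != fset0) && all2rel (fun X Y => (X `<=` Y) || (Y `<=` X))%fset C.

Section Face.
Variable S : {fset T}.

Let face (X : {fset T}) := (X != fset0) && (X `<=` S)%fset.

Let face_neq0 X : face X -> X != fset0.
Proof. by case/andP. Qed.

Let face_sub X Y : face X -> (Y `<=` X)%fset -> Y != fset0 -> face Y.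
Proof. by case/andP=> _ XS YX Y0; rewrite /face Y0 (fsubset_trans YX). Qed.

(** The simplex on [S] with all its faces: the complex in which [Sd_supported] confines the
    subdivision of a single tuple. *)
Definition full_complex := SComplex face_neq0 face_sub.
End Face.

Lemma supported_flags s :
  supported (all [pred C | flag C & all (fun X => (X != fset0) &&
    (X `<=` [fset x in s])%fset) C]) (Sd (Sd << s >>)).
Proof.
case: s => [|x s]; first by rewrite !SdU supportedU.
have : supported (tuple_in (full_complex [fset y in x :: s]%fset) (size s)) << x :: s >>.
  rewrite supportedU /tuple_in eqxx /= fsubset_refl andbT.
  by apply/fset0Pn; exists x; rewrite mem_fset_seq mem_head.
move=> /Sd_supported/Sd_supported; apply: supported_sub => t.
rewrite tuple_in_order => /and3P[_ tC _]; apply: sub_all tC => C /and3P[C0 CS CC].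
by rewrite /= /flag C0 CC.
Qed.
End Flags.

(** * Layers of a twice subdivided chain *)

Section Layers.
Variables (F : fieldType) (V : vectType F).
Implicit Types (C : {fset {fset V}}) (X Y : {fset V}) (s : seq V).

(** [Estar_to_J] at chain level, so that a cycle can be cut into faces that are not closed. *)
Definition symbol_chain (c : chain V) : chain ({vspace V} * {vspace V}) :=
  push (@chain_layer F V) (Sd (Sd c)).

HB.instance Definition _ := GRing.isZmodMorphism.Build _ _ symbol_chain
  (raddfB (push (@chain_layer F V) \o @Sd _ \o @Sd _)).

Lemma bd_symbol_chain c : bd (symbol_chain c) = symbol_chain (bd c).
Proof. by rewrite bd_push !bd_Sd. Qed.

Lemma flag_bounds C : flag C -> exists X Y,
  [/\ X \in C, Y \in C, (forall Z, Z \in C -> (X `<=` Z)%fset),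
      (forall Z, Z \in C -> (Z `<=` Y)%fset) & chain_layer C = (<<X>>, <<Y>>)%VS].
Proof.
case/andP=> C0 /(sort_chain C0); rewrite /chain_layer /=.
by set C' := sort _ C => -[]; exists (head fset0 C'), (last fset0 C').
Qed.

(** Least and greatest members are unique, so the layer can be read off without going through
    [sort]. *)
Lemma chain_layerE C X Y : flag C -> X \in C -> Y \in C ->
  (forall Z, Z \in C -> (X `<=` Z)%fset) ->
  (forall Z, Z \in C -> (Z `<=` Y)%fset) -> chain_layer C = (<<X>>, <<Y>>)%VS.
Proof.
move=> /flag_bounds[X' [Y' [X'C Y'C X'le Y'le ->]]] XC YC Xle Yle.
have -> : X' = X by apply/eqP; rewrite eqEfsubset X'le ?Xle.
by have -> : Y' = Y by apply/eqP; rewrite eqEfsubset Y'le ?Yle.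
Qed.

Lemma span_fsubset Y s : (Y `<=` [fset x in s])%fset -> (<<Y>> <= <<s>>)%VS.
Proof. by move=> /fsubsetP Ys; apply: sub_span => v /Ys; rewrite mem_fset_seq. Qed.

Lemma span_face_neq0 X Y s : 0 \notin s -> X != fset0 -> (X `<=` Y)%fset ->
  (Y `<=` [fset x in s])%fset -> <<X>>%VS != 0%VS.
Proof.
move=> s0 /fset0Pn[v vX] /fsubsetP XY /fsubsetP Ys; apply: contraNneq s0 => X0.
have := memv_span vX; rewrite X0 memv0 => /eqP <-.
by have := Ys _ (XY _ vX); rewrite mem_fset_seq.
Qed.

(** The layer of a flag of faces of [s] consists of the spans of its extremes, so only nested pairs
    of faces have to be tested. *)
Lemma supported_layers (P : pred ({vspace V} * {vspace V})) s :
  (forall X Y, X != fset0 -> (X `<=` Y)%fset -> (Y `<=` [fset x in s])%fset ->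
    P (<<X>>, <<Y>>)%VS) ->
  supported (all P) (symbol_chain << s >>).
Proof.
move=> PXY; apply: push_supported (supported_flags s) => t tC; rewrite all_map.
apply: sub_all tC => C /= /andP[/flag_bounds[X [Y [XC YC Xle _ ->]]] /allP CS].
have [X0 _] := andP (CS _ XC); have [_ YS] := andP (CS _ YC).
exact: PXY (Xle _ YC) YS.
Qed.

Lemma part_symbol_chain0 l s :
  (forall X Y, X != fset0 -> (X `<=` Y)%fset -> (Y `<=` [fset x in s])%fset ->
    (<<X>>, <<Y>>)%VS != l) ->
  part l (symbol_chain << s >>) = 0.
Proof.
move=> lXY; have := supported_layers (P := predC1 l) lXY.
move=> /supported_sub lc; apply/part_eq0/lc => t /allP tl.
by apply/negP => /tl; rewrite /= eqxx.
Qed.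

Lemma symbol_chain_supported p c : supported (tuple_in (Estar V) p) c ->
  supported (tuple_in (J V) p) (symbol_chain c).
Proof.
by move=> /Sd_supported/Sd_supported; apply: push_supported => s /chain_layer_tuple.
Qed.

Lemma symbol_chain_cycle p c : c \in cycles (Estar V) p ->
  symbol_chain c \in cycles (J V) p.
Proof.
rewrite !inE bd_symbol_chain => /andP[/symbol_chain_supported-> /eqP->].
by rewrite raddf0 eqxx.
Qed.
End Layers.

(** * Naturality of layers under linear maps *)

Section LayersNaturality.
Variables (F : fieldType) (V U : vectType F) (f : {linear V -> U}).

Definition map_layer (l : {vspace V} * {vspace V}) : {vspace U} * {vspace U} :=
  ((linfun f @: l.1)%VS, (linfun f @: l.2)%VS).

Lemma span_img (X : {fset V}) : <<img f X>>%VS = (linfun f @: <<X>>)%VS.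
Proof.
rewrite limg_span; apply: eq_span => y; apply/imfsetP/mapP => -[x xX ->];
  by exists x; rewrite // lfunE.
Qed.

(** Images preserve inclusion, so extremes of [C] go to extremes of its image, and spans commute
    with linear images. *)
Lemma chain_layer_img (C : {fset {fset V}}) : flag C ->
  chain_layer (img (img f) C) = map_layer (chain_layer C).
Proof.
move=> flagC; have [X [Y [XC YC Xle Yle ->]]] := flag_bounds flagC.
rewrite /map_layer /= -!span_img.
have fS (A B : {fset V}) : (A `<=` B)%fset -> (img f A `<=` img f B)%fset.
  by move=> AB; apply: subset_imfset; apply/fsubsetP.
apply: chain_layerE; rewrite ?in_imfset //.
- have [C0 /allrelP CC] := andP flagC; apply/andP; split.
    by apply/fset0Pn; exists (img f X); rewrite in_imfset.
  apply/allrelP => _ _ /imfsetP[A /= AC ->] /imfsetP[B /= BC ->].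
  by case/orP: (CC _ _ AC BC) => /fS->; rewrite ?orbT.
- by move=> _ /imfsetP[A /= AC ->]; apply/fS/Xle.
- by move=> _ /imfsetP[A /= AC ->]; apply/fS/Yle.
Qed.

Lemma push_symbol_chain c :
  push map_layer (symbol_chain c) = symbol_chain (push f c).
Proof.
apply: (chain_ext (f := push map_layer \o @symbol_chain F V)
  (g := @symbol_chain F U \o push f)) c => s /=.
rewrite /symbol_chain -!push_Sd !push_comp; apply/esym/eq_push.
apply: supported_sub (supported_flags s) => t; apply: sub_all => C /andP[flagC _].
by apply/eqP/chain_layer_img.
Qed.
End LayersNaturality.

Lemma mem_omit_nth (T : eqType) (x : T) (s : seq T) i j :
  (i < size s)%N -> i != j -> nth x s i \in omit j s.
Proof.
move=> si; rewrite mem_cat neq_ltn => /orP[ij|ji].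
  by rewrite -(nth_take x ij) mem_nth // size_take_min leq_min ij.
rewrite orbC -{1}(subnKC ji) -nth_drop mem_nth // size_drop.
exact: ltn_sub2r (leq_ltn_trans ji si) si.
Qed.

Lemma supported_all_bd (T : choiceType) (P : pred T) (c : chain T) :
  supported (all P) c -> supported (all P) (bd c).
Proof.
apply: supported_bd => s i /allP Ps _; apply/allP => x /mem_omit.
exact: Ps.
Qed.

(** * Cycles of [E^*(V)] and the position of a zero entry *)

Section Estar.
Variables (F : fieldType) (V : vectType F).
Implicit Types s : seq V.

Lemma Estar_tuple s : (0 < size s)%N ->
  tuple_in (Estar V) (size s).-1 s = ((0 \in s) ==> (<<s>>%VS != fullv)).
Proof.
case: s => // x s _; rewrite /tuple_in eqxx /= /Estar_simplex mem_fset_seq.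
have -> : (<<[fset x0 | x0 in x :: s]%fset>> = <<x :: s>> :> {vspace V})%VS.
  by apply/eq_span => v; rewrite mem_fset_seq.
by rewrite andb_idl // => _; apply/fset0Pn; exists x; rewrite mem_fset_seq mem_head.
Qed.

Lemma Estar_tuple0 s : (<<s>>%VS != fullv) -> tuple_in (Estar V) (size s) (0 :: s).
Proof.
move=> sV; rewrite -[size s]/(size (0 :: s)).-1 Estar_tuple //.
by rewrite span_cons add0v sV implybT.
Qed.

(** A zero entry can be removed without changing the span, and fewer than [dim V] vectors remain. *)
Lemma span_with0 s : (size s <= \dim {:V})%N -> 0 \in s -> <<s>>%VS != fullv.
Proof.
move=> sV s0; have -> : (<<s>> = <<rem 0%R s>> :> {vspace V})%VS.
  rewrite -[RHS]add0v -span_cons; apply: eq_span; apply: perm_mem.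
  exact: perm_to_rem.
apply/eqP => rV; have := dim_span (rem 0 s); rewrite rV size_rem // leqNgt.
by rewrite (leq_trans _ sV) // ltn_predL; case: (s) s0.
Qed.

(** Every face has [dim V] entries, so one containing 0 cannot span. The tuple [s] itself may fail
    to be a simplex, so the class need not vanish. *)
Lemma bd_cycle s : (1 < size s)%N -> (size s).-1 = \dim {:V} ->
  bd << s >> \in cycles (Estar V) (\dim {:V}).-1.
Proof.
move=> s1 sV; rewrite inE bdK eqxx andbT bdU; apply: supported_sum => i _.
apply: supportedZ; rewrite supportedU.
have so : size (omit i s) = \dim {:V} by rewrite size_omit.
rewrite -so Estar_tuple ?so; last by rewrite -sV -subn1 subn_gt0.
by apply/implyP => /span_with0->; rewrite ?so.
Qed.

(* [<< s >> - (-1)^i << 0 :: omit i s >>] is [bd << 0 :: s >>] up to the tuples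
   [0 :: omit j s] with [j != i], which lie in [E^*(V)]. *)
Lemma symbol_move0 s i : (i < size s)%N -> (1 < size s)%N ->
    (size s).-1 = \dim {:V} -> s`_i = 0 ->
  (class _ _ (symbol_chain (bd << s >>)) : St V) = symbol (omit i s) *~ (-1) ^+ i.
Proof.
move=> si s1 sV s0.
have V0 : (0 < \dim {:V})%N by rewrite -sV -subn1 subn_gt0.
have so j : (j < size s)%N -> size (omit j s) = \dim {:V}.
  by move=> sj; rewrite size_omit.
pose b : chain V := \sum_(j < size s | j != i :> nat) << 0 :: omit j s >> *~ (-1) ^+ j.
have bdE : bd << s >> - bd << 0 :: omit i s >> *~ (-1) ^+ i = bd b.
  have : bd (<< s >> - bd << 0 :: s >>) =
      bd (\sum_(j < size s) (<< 0 :: omit j s >> : chain V) *~ (-1) ^+ j).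
    rewrite bd_cons opprB addrC subrK bdU raddf_sum; congr bd.
    by apply: eq_bigr => j _; rewrite raddf_scalez /= coneU -scaler_int intz.
  rewrite raddfB /= bdK subr0 (bigD1 (Ordinal si)) //= raddfD /= => ->.
  by rewrite raddfMz addrC addKr.
have Zi := symbol_chain_cycle (symbol_cycle V0 (so _ si)).
rewrite symbolE ?so // -/(symbol_chain _) -classMz //.
apply: (proj2 (class_homologous (b := symbol_chain b) _ _ _)).
- exact: rpredMz.
- rewrite prednK //; apply: symbol_chain_supported; rewrite /b -big_filter.
  apply: supported_sum => j; rewrite mem_filter => /andP[ji _].
  rewrite -scaler_int intz; apply: supportedZ; rewrite supportedU.
  rewrite -(so _ (ltn_ord j)) Estar_tuple0 // span_with0 ?so //.
  by rewrite -s0 mem_omit_nth // eq_sym.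
by rewrite bd_symbol_chain -bdE -raddfMz -raddfB.
Qed.
End Estar.

(** * The Mayer-Vietoris boundary of a single face *)

Section Boundary.
Variables (F : fieldType) (V : vectType F).
Implicit Types (l : {vspace V} * {vspace V}) (s : seq V).
Implicit Types (c : chain ({vspace V} * {vspace V})).

(** By [subr_part], only tuples avoiding [l] survive in [c - part l c]; this supplies the first
    hypothesis of [mv_boundary_class]. *)
Lemma push_away (T : choiceType) (K : scomplex T)
    (phi : {vspace V} * {vspace V} -> T) l p (P : pred (seq _)) c :
  (forall t, P t -> l \notin t -> tuple_in K p (map phi t)) ->
  supported P c -> supported (tuple_in K p) (push phi (c - part l c)).
Proof.
move=> PK Pc; rewrite subr_part; pose Q t := P t && (l \notin t).
apply: (push_supported (P := Q)) => [t /andP[]|]; first exact: PK.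
apply: supported_lift Pc => t Pt; case: ifPn => lt; first exact: supported0.
by rewrite supportedU /Q Pt.
Qed.

(** [mv_boundary l c + bd c] is the boundary of [c - part l c]. Here [c] need not be a cycle: it
    will be one face of a symbol. *)
Lemma mv_boundary_class (T : choiceType) (K : scomplex T)
    (phi : {vspace V} * {vspace V} -> T) l p c :
  supported (tuple_in K p.+1) (push phi (c - part l c)) ->
  push phi (bd c) \in cycles K p ->
  push phi (mv_boundary l c) \in cycles K p /\
  class K p (push phi (mv_boundary l c)) = - class K p (push phi (bd c)).
Proof.
move=> Kc Zc; rewrite -classN //.
apply: class_homologous Kc _; first by rewrite rpredN.
by rewrite opprK bd_push -!raddfD /= /mv_boundary [bd (_ - _)]raddfB addrC.
Qed.

(** Inside [W], preimage under the inclusion is image under the projection; this turns [sub_layer]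
    into a [map_layer], to which [push_symbol_chain] applies. *)
Lemma sub_layerE (W : {vspace V}) l : (l.1 <= W)%VS -> (l.2 <= W)%VS ->
  sub_layer W l = map_layer (@vsproj _ _ W) l.
Proof.
have pre (X : {vspace V}) : (X <= W)%VS ->
    (linfun (@vsval _ _ W) @^-1: X = linfun (@vsproj _ _ W) @: X)%VS.
  move=> /subvP XW; apply/vspaceP => u; rewrite -memv_preim lfunE /=.
  apply/idP/memv_imgP => [uX|[v vX ->]].
    by exists (vsval u); rewrite // lfunE /= vsvalK.
  by rewrite lfunE /= vsprojK ?XW.
by move=> l1 l2; rewrite /sub_layer /map_layer !pre.
Qed.

(** [0 :: s] is a tuple of [E^*(V)] because [s] spans only [W]. Its layers lie in [W], where only
    [(0, W)] is improper, and its boundary becomes the symbol cycle of [s]. *)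
Lemma sub_boundary (W : {vspace V}) s : (0 < size s)%N ->
  \dim {:V} = (size s).+1 -> \dim W = size s -> <<s>>%VS = W ->
  let c := push (sub_layer W) (mv_boundary (0%VS, W) (symbol_chain << 0 :: s >>)) in
  c \in cycles (J (subvs_of W)) (\dim {:subvs_of W}).-1 /\
  (class _ _ c : St (subvs_of W)) = - symbol (map (vsproj W) s).
Proof.
move=> s0 dV dW sW; rewrite /=.
have dU : \dim {:subvs_of W} = size s by rewrite dim_subvs.
set y := symbol_chain _.
have Jy : supported (tuple_in (J V) (size s)) y.
  apply: symbol_chain_supported; rewrite supportedU Estar_tuple0 // sW.
  by apply/eqP => WV; move: dV; rewrite -WV dW; apply: n_Sn.
have yW : supported (all (fun x => (x.1 <= x.2 <= W)%VS)) y.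
  apply: supported_layers => X Y _ /fsubsetP XY Ys /=.
  by rewrite (sub_span XY) -sW -[<<s>>%VS]add0v -span_cons span_fsubset.
have mapE : push (sub_layer W) (bd y) =
    symbol_chain (bd << 0 :: map (vsproj W) s >>).
  transitivity (push (map_layer (@vsproj _ _ W)) (bd y)).
    apply: eq_push; apply: supported_sub (supported_all_bd yW) => t.
    apply: sub_all => x /andP[x12 x2]; apply/eqP/sub_layerE => //.
    exact: subv_trans x12 x2.
  rewrite -bd_push push_symbol_chain pushU bd_symbol_chain /=.
  by rewrite -(linear0 (vsproj W)).
rewrite symbolE ?size_map ?dU // -/(symbol_chain _) -mapE.
apply: mv_boundary_class; last first.
  rewrite mapE; apply/symbol_chain_cycle/symbol_cycle; rewrite ?size_map dU //.
rewrite dU prednK //.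
pose P t := tuple_in (J V) (size s) t && all (fun x => (x.1 <= x.2 <= W)%VS) t.
apply: (push_away (P := P)); last first.
  by apply/allP => t ty; rewrite /P (allP Jy) // (allP yW).
move=> t /andP[Jt /allP tW] lt; apply: sub_layer_tuple.
move: Jt; rewrite !tuple_in_order => /and3P[-> /allP tJ ->]; rewrite andbT /=.
apply/allP => x xt /=; rewrite [proper_layer x]tJ //=.
have /andP[x12 x2] := tW _ xt; rewrite /layer_le /= sub0v x12 x2 /=.
by apply: contraNneq lt => <-.
Qed.

Lemma quov_full (L Y : {vspace V}) : (L <= Y)%VS ->
  (linfun (@quov_pi _ _ L) @: Y)%VS = fullv -> Y = fullv.
Proof.
move=> /subvP LY YV; apply/eqP; rewrite eqEsubv subvf; apply/subvP => v _.
have /memv_imgP[u uY] : quov_pi L v \in (linfun (@quov_pi _ _ L) @: Y)%VS.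
  by rewrite YV memvf.
by rewrite lfunE /= => /quov_eq/LY vu; rewrite -(subrK u v) memvD.
Qed.

Lemma quo_boundary (L : {vspace V}) s : (1 < \dim {:V})%N -> \dim L = 1 ->
  size s = \dim {:V} -> 0 \notin s ->
  let c := push (quo_layer L) (mv_boundary (L, fullv) (symbol_chain << s >>)) in
  (class _ _ c : St (quov L)) =
    - class _ _ (symbol_chain (bd << map (@quov_pi _ _ L) s >>)).
Proof.
move=> V1 dL sV s0; rewrite /=.
have pU : (\dim {:quov L}).-1.+1 = (size s).-1.
  by rewrite dim_quov dL sV subn1 prednK // -subn1 subn_gt0.
set y := symbol_chain << s >>.
have mapE : push (quo_layer L) (bd y) = symbol_chain (bd << map (@quov_pi _ _ L) s >>).
  have -> : push (quo_layer L) = push (map_layer (@quov_pi _ _ L)) by [].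
  by rewrite -bd_push push_symbol_chain pushU bd_symbol_chain.
rewrite -mapE.
have Zs : push (quo_layer L) (bd y) \in cycles (J (quov L)) (\dim {:quov L}).-1.
  rewrite mapE; apply: symbol_chain_cycle; apply: bd_cycle; rewrite size_map sV //.
  by rewrite dim_quov dL subn1.
suff: supported (tuple_in (J (quov L)) (\dim {:quov L}).-1.+1)
    (push (quo_layer L) (y - part (L, fullv) y)).
  by move=> /mv_boundary_class/(_ Zs)[].
have Jy : supported (tuple_in (J V) (size s).-1) y.
  apply: symbol_chain_supported; rewrite supportedU Estar_tuple ?(negPf s0) //.
  by rewrite sV ltnW.
have y0 : supported (all (fun x => x.1 != 0%VS)) y.
  by apply: supported_layers => X Y; apply: span_face_neq0.
pose P t := tuple_in (J V) (size s).-1 t && all (fun x => x.1 != 0%VS) t.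
apply: (push_away (P := P)); last first.
  by apply/allP => t ty; rewrite /P (allP Jy) // (allP y0).
move=> t /andP[Jt /allP t0] lt; rewrite pU.
move: Jt; rewrite !tuple_in_order size_map => /and3P[-> /allP tJ /allrelP tc] /=.
(* These layers need not lie below [(L, V)], so [quo_layer_tuple] does not apply; monotonicity of
   images still gives comparability. *)
have le_quo x x' : layer_le x x' -> layer_le (quo_layer L x) (quo_layer L x').
  by case/and3P=> *; apply/and3P; split; apply: limgS.
apply/andP; split; last first.
  apply/allrelP => _ _ /mapP[x xt ->] /mapP[x' x't ->].
  by case/orP: (tc _ _ xt x't) => ?; apply/orP; [left | right]; apply: le_quo.
apply/allP => _ /mapP[[X Y] xt ->]; have /andP[/= XY _] := tJ _ xt.
rewrite /proper_layer /= limgS //=; apply: contra lt => /eqP E.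
have X0 : (linfun (@quov_pi _ _ L) @: X = 0)%VS := congr1 fst E.
have YV : (linfun (@quov_pi _ _ L) @: Y = fullv)%VS := congr1 snd E.
(* [X] is non-zero and contained in the line [L], hence equal to it; then [L <= Y], and [Y] is all
   of [V]. *)
have XL : X = L.
  apply/eqP; rewrite eqEdim dL lt0n dimv_eq0 (t0 _ xt) andbT.
  apply/subvP => v /(memv_img (linfun (@quov_pi _ _ L))).
  by rewrite X0 memv0 -memv_ker quov_pi_lker.
by rewrite -[Y in (_, Y)](quov_full _ YV) -?{1}XL.
Qed.
End Boundary.

(** * Spans of images and of tuples with one entry omitted *)

Lemma map_omit (T U : Type) (f : T -> U) i (s : seq T) :
  map f (omit i s) = omit i (map f s).
Proof. by rewrite map_cat map_take map_drop. Qed.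

Section Span.
Variables (F : fieldType) (V : vectType F).
Implicit Types s : seq V.

Lemma span_map (U : vectType F) (f : {linear V -> U}) (s : seq V) :
  <<map f s>>%VS = (linfun f @: <<s>>)%VS.
Proof.
by rewrite limg_span; congr span; apply: eq_map => v; rewrite lfunE.
Qed.

Lemma span_omit i s : (i < size s)%N -> s`_i \in <<omit i s>>%VS ->
  <<omit i s>>%VS = <<s>>%VS.
Proof.
move=> si sL; apply/eqP; rewrite eqEsubv sub_span; last exact: mem_omit.
apply/span_subvP => _ /(nthP 0)[j js <-]; have [->//|ji] := eqVneq j i.
exact/memv_span/mem_omit_nth.
Qed.
End Span.

(** * Components of [d1] on a symbol *)

Section Formula.
Variables (F : fieldType) (V : vectType F).
Implicit Types (s g : seq V).

Definition sub_at (U : hyperplane V) (x : target V) : St (subvs_of (val U)) := x.1 U.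
Definition quo_at (L : line V) (x : target V) : St (quov (val L)) := x.2 L.

HB.instance Definition _ (U : hyperplane V) :=
  GRing.isZmodMorphism.Build (target V) (St (subvs_of (val U))) (sub_at U)
    (fun _ _ => erefl).
HB.instance Definition _ (L : line V) :=
  GRing.isZmodMorphism.Build (target V) (St (quov (val L))) (quo_at L)
    (fun _ _ => erefl).

Lemma target_eq (x y : target V) :
  (forall U, sub_at U x = sub_at U y) -> (forall L, quo_at L x = quo_at L y) -> x = y.
Proof.
by case: x y => [x1 x2] [y1 y2] E1 E2; congr (_, _); apply: dsumP.
Qed.

Lemma sub_at_quo U (L : {vspace V}) s : sub_at U (at_quo L s) = 0.
Proof. by rewrite /at_quo; case: insubP => [L' _ _|_] //=. Qed.

Lemma quo_at_sub L (W : {vspace V}) s : quo_at L (at_sub W s) = 0.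
Proof. by rewrite /at_sub; case: insubP => [U' _ _|_] //=. Qed.

Lemma sub_at_sub U (W : {vspace V}) s : sub_at U (at_sub W s) =
  if W == val U then symbol_or0 (map (vsproj (val U)) s) else 0.
Proof.
rewrite /at_sub; case: insubP => [U' _ <-|].
  rewrite -[LHS]/(single U' _ U) (inj_eq val_inj); case: eqP => [->|/eqP].
    exact: (@singleE _ (fun U : hyperplane V => St (subvs_of (val U)))).
  exact: (@single_neq _ (fun U : hyperplane V => St (subvs_of (val U)))).
by case: (W =P val U) => [-> /negP[]|//]; exact: valP U.
Qed.

Lemma quo_at_quo L (L0 : {vspace V}) s : quo_at L (at_quo L0 s) =
  if L0 == val L then symbol_or0 (map (@quov_pi _ _ (val L)) s) else 0.
Proof.
rewrite /at_quo; case: insubP => [L' _ <-|].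
  rewrite -[LHS]/(single L' _ L) (inj_eq val_inj); case: eqP => [->|/eqP].
    exact: (@singleE _ (fun L : line V => St (quov (val L)))).
  exact: (@single_neq _ (fun L : line V => St (quov (val L)))).
by case: (L0 =P val L) => [-> /negP[]|//]; exact: valP L.
Qed.

(** The index [i] counts from 0, so [(-1)^(i+1)] is the usual sign attached to the vector in
    position [i + 1]. *)
Lemma symbol_chain_cone (g : seq V) :
  symbol_chain (bd << 0 :: g >>) = symbol_chain << g >>
    + \sum_(i < size g) symbol_chain << 0 :: omit i g >> *~ (-1) ^+ i.+1.
Proof.
rewrite bd_cons raddfB; congr (_ + _).
rewrite -raddfN bdU raddf_sum -sumrN raddf_sum /=.
apply: eq_bigr => i _; rewrite raddf_scalez /= coneU -scaleNr -mulN1r -exprS.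
by rewrite raddf_scalez -scaler_int intz.
Qed.

(** The omitted vector becomes 0 in [V/L], so omitting it keeps the span there; and [L] lies in the
    span of [s]. This decides when [symbol_or0] is 0. *)
Lemma span_quo_omit (L : {vspace V}) i s : (i < size s)%N -> <[s`_i]>%VS = L ->
  (<<map (quov_pi L) (omit i s)>>%VS == fullv) = (<<s>>%VS == fullv).
Proof.
move=> si Li; have sL : s`_i \in L by rewrite -Li memv_line.
rewrite map_omit span_omit ?size_map //; last first.
  rewrite (nth_map 0) //; suff -> : quov_pi L s`_i = 0 by rewrite mem0v.
  by rewrite -(raddf0 (quov_pi L)); apply/quov_eq; rewrite subr0.
rewrite span_map; apply/eqP/eqP => [|->]; last exact: quov_pi_surj.
by apply: quov_full; rewrite -Li -memvE memv_span // mem_nth.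
Qed.

Variable g : seq V.
Hypotheses (V1 : (1 < \dim {:V})%N) (gV : size g = \dim {:V}) (g0 : 0 \notin g).

Let so i : (i < size g)%N -> (size (omit i g)).+1 = \dim {:V}.
Proof. by move=> ig; rewrite size_omit // prednK // gV ltnW. Qed.

Let omit_small i : (i < size g)%N -> (<<omit i g>>%VS != fullv).
Proof.
move=> ig; apply/eqP => E; have := dim_span (omit i g).
by rewrite E -(so ig) ltnn.
Qed.

(** When [g] does not span [V], several [i] can give the same hyperplane, hence a sum over them. *)
Lemma sub_at_d1 U : sub_at U (d1 (symbol g)) =
  - \sum_(i < size g | <<omit i g>>%VS == val U)
      symbol (map (vsproj (val U)) (omit i g)) *~ (-1) ^+ i.+1.
Proof.
have dU := eqP (valP U).
rewrite symbolE ?(ltnW V1) // -/(symbol_chain _) d1E //; last first.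
  exact/symbol_chain_cycle/symbol_cycle/gV/ltnW.
rewrite /sub_at /= /d1_sub symbol_chain_cone.
set l := (_, _); set y := fun i => symbol_chain << 0 :: omit i g >>.
have -> : mv_boundary l (symbol_chain << g >> + \sum_(i < size g) y i *~ (-1) ^+ i.+1)
  = \sum_(i < size g | <<omit i g>>%VS == val U) mv_boundary l (y i) *~ (-1) ^+ i.+1.
  rewrite /mv_boundary !raddfD /= part_symbol_chain0 ?raddf0 ?add0r.
    rewrite !raddf_sum [RHS]big_mkcond; apply: eq_bigr => i _ /=.
    case: ifPn => iU; rewrite !raddfMz /= ?mulNrz //.
    rewrite part_symbol_chain0 ?raddf0 ?mul0rz ?oppr0 // => X Y _ _ Ys.
    (* Here [U] lies in the span of [n - 1] vectors and has dimension [n - 1], which forces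
       equality. *)
    apply: contra iU => /eqP[_ YU]; rewrite eq_sym eqEdim -YU; apply/andP; split.
      by rewrite -[<<omit i g>>%VS]add0v -span_cons span_fsubset.
    by rewrite YU dU -(so (ltn_ord i)) dim_span.
  (* The face [g] has no zero entry, so the first member of each of its layers is non-zero. *)
  by move=> X Y X0 XY Yg; apply: contraNneq (span_face_neq0 g0 X0 XY Yg) => -[->].
have bound (i : 'I_(size g)) (iU : <<omit i g>>%VS == val U) :
    push (sub_layer (val U)) (mv_boundary l (y i)) \in
      cycles (J (subvs_of (val U))) (\dim {:subvs_of (val U)}).-1 /\
    (class _ _ (push (sub_layer (val U)) (mv_boundary l (y i))) : St (subvs_of (val U)))
      = - symbol (map (vsproj (val U)) (omit i g)).
  have io := so (ltn_ord i).
  by apply: sub_boundary; rewrite ?io ?dU -?io //; [rewrite -ltnS io | exact/eqP].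
have -> : push (sub_layer (val U))
      (\sum_(i < size g | <<omit i g>>%VS == val U) mv_boundary l (y i) *~ (-1) ^+ i.+1)
    = \sum_(i < size g | <<omit i g>>%VS == val U)
        push (sub_layer (val U)) (mv_boundary l (y i)) *~ (-1) ^+ i.+1.
  by rewrite raddf_sum; apply: eq_bigr => i _; rewrite raddfMz.
rewrite class_sum => [|i /bound[]//]; rewrite -sumrN.
by apply: eq_bigr => i /bound[_ ->]; rewrite mulNrz.
Qed.

Lemma quo_at_d1 L : quo_at L (d1 (symbol g)) =
  if <<g>>%VS == fullv then
    \sum_(i < size g | <[g`_i]>%VS == val L)
      symbol (map (@quov_pi _ _ (val L)) (omit i g)) *~ (-1) ^+ i.+1
  else 0.
Proof.
have dL := eqP (valP L).
rewrite symbolE ?(ltnW V1) // -/(symbol_chain _) d1E //; last first.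
  exact/symbol_chain_cycle/symbol_cycle/gV/ltnW.
rewrite /quo_at /= /d1_quo symbol_chain_cone.
set l := (_, _).
(* The faces [0 :: omit i g] do not span [V], so they miss [(L, V)]. *)
have -> : mv_boundary l (symbol_chain << g >>
    + \sum_(i < size g) symbol_chain << 0 :: omit i g >> *~ (-1) ^+ i.+1)
  = mv_boundary l (symbol_chain << g >>).
  rewrite /mv_boundary !raddfD /= !raddf_sum big1 ?raddf0 ?addr0 // => i _.
  rewrite !raddfMz /= part_symbol_chain0 ?raddf0 ?mul0rz // => X Y _ _ Ys.
  apply: contraNneq (omit_small (ltn_ord i)) => -[_ YV].
  by rewrite eqEsubv subvf -YV -[<<omit i g>>%VS]add0v -span_cons span_fsubset.
have part0 : (forall X Y : {fset V}, X != fset0 -> (X `<=` Y)%fset ->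
    (Y `<=` [fset x in g])%fset -> (<<X>>, <<Y>>)%VS != l) ->
  class (J (quov (val L))) (\dim {:quov (val L)}).-1
    (push (quo_layer (val L)) (mv_boundary l (symbol_chain << g >>))) = 0.
  by move=> /part_symbol_chain0 lg; rewrite /mv_boundary lg !raddf0 class0.
case: ifPn => [gfull|gN]; last first.
  apply: part0 => X Y _ _ Yg; apply: contra gN => /eqP[_ YV].
  by rewrite eqEsubv subvf -YV span_fsubset.
case: (pickP (fun i : 'I_(size g) => <[g`_i]>%VS == val L)) => [i iL|noL]; last first.
  (* A non-empty [X] spanning [L] would contain a non-zero vector of [g], which would generate
     [L]. *)
  rewrite big_pred0 //; apply: part0 => X Y /fset0Pn[v vX] /fsubsetP XY /fsubsetP Yg.
  have vg : v \in g by have := Yg _ (XY _ vX); rewrite mem_fset_seq.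
  apply/eqP => -[XL _]; have vg' := vg; rewrite -index_mem in vg'.
  have /negP[] := noL (Ordinal vg'); rewrite /= nth_index // eqEdim dL dim_vline.
  rewrite -memvE -XL memv_span //= lt0b.
  by apply: contraNneq g0 => <-.
have Lg : val L = <[g`_i]>%VS by rewrite (eqP iL).
(* The index is unique: a second vector of [g] on [L] would leave [omit i g] spanning [V]. *)
rewrite (big_pred1 i) => [|j /=]; last first.
  apply/eqP/eqP => [E|->]; last by rewrite Lg.
  apply/eqP; apply: contraNT (omit_small (ltn_ord i)) => ji.
  rewrite span_omit //; have : g`_i \in <[g`_j]>%VS by rewrite E Lg memv_line.
  rewrite memvE => /subv_trans; apply; rewrite -memvE memv_span //.
  exact: mem_omit_nth.
have := quo_boundary V1 dL gV g0; rewrite -/l => /= ->.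
have dQ : (size g).-1 = \dim {:quov (val L)} by rewrite dim_quov dL gV subn1.
(* The image tuple has 0 at position [i]; moving it to the front gives [(-1)^i], and the minus sign
   of [quo_boundary] makes this [(-1)^(i+1)]. *)
rewrite (symbol_move0 (i := i)) ?size_map ?gV //; last 2 first.
- by rewrite -dQ gV.
- rewrite (nth_map 0) // -(raddf0 (quov_pi (val L))); apply/quov_eq.
  by rewrite subr0 Lg memv_line.
by rewrite -map_omit exprS mulN1r mulrNz.
Qed.

Lemma d1_symbol :
  d1 (symbol g) =
    - (\sum_(i < size g) at_sub <<omit i g>>%VS (omit i g) *~ (-1) ^+ i.+1)
    + \sum_(i < size g) at_quo <[g`_i]>%VS (omit i g) *~ (-1) ^+ i.+1.
Proof.
apply: target_eq => [U|L].
  rewrite sub_at_d1 raddfD raddfN /= !raddf_sum /=.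
  rewrite [X in _ + X]big1 ?addr0 => [|i _]; last first.
    by rewrite raddfMz /= sub_at_quo mul0rz.
  rewrite big_mkcond; apply: eq_bigr => i _.
  rewrite [sub_at U _]raddfMz /= sub_at_sub; case: ifP => [/eqP iU|_]; last first.
    by rewrite mul0rz oppr0.
  (* The projection maps [<<omit i g>> = U] onto the whole space [U], so [symbol_or0] is the
     symbol. *)
  rewrite /symbol_or0 ifT // span_map iU; apply/eqP/vspaceP => u.
  rewrite memvf; apply/memv_imgP; exists (vsval u); first exact: subvsP.
  by rewrite lfunE /= vsvalK.
rewrite quo_at_d1 raddfD raddfN /= !raddf_sum /=.
rewrite [X in X + _]big1 ?add0r => [|i _]; last first.
  by rewrite raddfMz /= quo_at_sub mul0rz oppr0.
case: ifPn => gfull.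
  rewrite big_mkcond; apply: eq_bigr => i _.
  rewrite raddfMz /= quo_at_quo; case: ifP => [/eqP iL|_]; last by rewrite mul0rz.
  by rewrite /symbol_or0 (span_quo_omit (ltn_ord i) iL) gfull.
(* If [g] does not span [V], no image tuple spans [V/L], and every term is read as 0. *)
rewrite big1 // => i _; rewrite raddfMz /= quo_at_quo; case: ifP => [/eqP iL|_].
  by rewrite /symbol_or0 (span_quo_omit (ltn_ord i) iL) (negPf gfull) mul0rz.
by rewrite mul0rz.
Qed.
End Formula.

Theorem theorem5p10 (A : idomainType) (n : nat) (d : lmodType A)
    (V : vectType {fraction A}) (iota : semilin d V) (g : n.-tuple V)
    (hA : noetherian A) (hn : (2 <= n)%N)
    (d_fg : finitely_generated d) (d_tf : torsion_free d)
    (hV : is_base_change iota) (d_rank : \dim {:V} = n)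
    (g_neq0 : forall i : 'I_n, tnth g i != 0) :
  d1 (symbol g) =
    - (\sum_(i < n) at_sub <<omit i g>>%VS (omit i g) *~ (-1) ^+ i.+1)
    + \sum_(i < n) at_quo <[tnth g i]>%VS (omit i g) *~ (-1) ^+ i.+1.
Proof.
have gE (i : 'I_n) : tnth g i = g`_i := tnth_nth 0 g i.
under [X in _ + X]eq_bigr => i _ do rewrite gE.
have g0 : 0 \notin g by apply/tnthP => -[i gi0]; have := g_neq0 i; rewrite -gi0 eqxx.
by rewrite d1_symbol ?d_rank ?size_tuple.
Qed.
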